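(* Let $A$ be a noetherian connected graded algebra generated in degree $1$ and suppose there is a finite map $T\to A$ where $T$ is a noetherian connected graded algebra of finite global dimension. Then $A^{(d)}$ is Koszul for $d\gg0$ (that is, for all sufficiently large integers $d$).
   Context: $k$ is a field. A connected graded algebra is an $\mathbb{N}$-graded $k$-algebra $A=\bigoplus_{i\ge 0}A_i$ with $A_0=k$; $k$ also denotes the graded $A$-bimodule $A/A_{\ge1}$. Noetherian means left and right noetherian. A graded algebra map $\phi:T\to A$ is finite if ${}_TA$ and $A_T$ are finitely generated $T$-modules. For an integer $d\ge2$ the $d$th Veronese subring of $A$ is $A^{(d)}=\bigoplus_{i\ge0}A_{di}$, regraded so that elements of $A_{di}$ have degree $i$. A connected graded algebra $B$ is Koszul if $\mathrm{Tor}^B_i(k,k)_j=0$ for all $j\ne i$ (equivalently, the trivial module $k$ has a minimal graded free resolution whose $i$th term is a direct sum of copies of $B(-i)$). *)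

(* Defs.v *)
From HB Require Import structures.
From mathcomp Require Import all_boot all_order all_algebra.
From mathcomp Require Import boolp.

Set Implicit Arguments.
Unset Strict Implicit.
Unset Printing Implicit Defensive.

Import GRing.Theory.
Local Open Scope ring_scope.

(* A direct sum decomposition V = \bigoplus_(i : I) V_i, given by its           *)
(* projections comp i : V -> V_i; the summand V_i is recovered as homog i.      *)
Record grading (I : eqType) (V : zmodType) := Grading {
  comp : I -> {additive V -> V};
  comp_comp : forall i j x, comp i (comp j x) = if i == j then comp j x else 0;
  comp_sum : forall x, exists2 s : seq I, uniq s & x = \sum_(i <- s) comp i x }.

Definition homog (I : eqType) (V : zmodType) (g : grading I V) (i : I) (x : V)
  : Prop := comp g i x = x.

Lemma comp_homog (I : eqType) (V : zmodType) (g : grading I V) i j x :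
  homog g j x -> i != j -> comp g i x = 0.
Proof. by move=> <- /negbTE ne; rewrite comp_comp ne. Qed.

Lemma homog_comp (I : eqType) (V : zmodType) (g : grading I V) i x :
  homog g i (comp g i x).
Proof. by rewrite /homog comp_comp eqxx. Qed.

Record cgalg (k : fieldType) := CGAlg {
  cg_alg :> algType k;
  cg_gr : grading nat cg_alg;
  cg_homM : forall i j x y,
    homog cg_gr i x -> homog cg_gr j y -> homog cg_gr (i + j)%N (x * y);
  cg_hom0 : forall x, homog cg_gr 0%N x <-> exists c : k, x = c%:A }.

Section CgAlgTheory.
Variables (k : fieldType) (A : cgalg k).
Local Notation pr := (comp (cg_gr A)).

Lemma scalar_homog (c : k) : homog (cg_gr A) 0%N (c%:A : A).
Proof. by apply/cg_hom0; exists c. Qed.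

Lemma compZ i (c : k) (x : A) : pr i (c *: x) = c *: pr i x.
Proof.
have hZ j (y : A) : homog (cg_gr A) j y -> homog (cg_gr A) j (c *: y).
  move=> hy; rewrite -mulr_algl -[j]add0n.
  by apply: cg_homM => //; apply: scalar_homog.
have [s us xE] := comp_sum (cg_gr A) x.
have comp_i (t : seq nat) (z : A) : uniq t ->
    pr i (\sum_(j <- t) c *: pr j z) = c *: pr i (\sum_(j <- t) pr j z).
  move=> ut; rewrite !raddf_sum /=; apply: eq_bigr => j _.
  rewrite comp_comp; case: eqP => [<-|/eqP ne].
    by rewrite (hZ i (pr i z)) //; apply: homog_comp.
  by rewrite scaler0 (comp_homog (hZ _ _ (homog_comp _ j z))).
by rewrite {1}xE scaler_sumr comp_i // -xE.
Qed.

Lemma augm_subproof (x : A) : exists c : k, pr 0%N x == c%:A.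
Proof.
have /cg_hom0[c cE] := homog_comp (cg_gr A) 0%N x.
by exists c; apply/eqP.
Qed.

(* The augmentation A -> A / A_{>= 1} = k.                                      *)
Definition augm (x : A) : k := xchoose (augm_subproof x).

Lemma augmE (x : A) : pr 0%N x = (augm x)%:A.
Proof. exact/eqP/(xchooseP (augm_subproof x)). Qed.

Lemma scalarA_inj : injective (fun c : k => c%:A : A).
Proof.
move=> a b /eqP; rewrite -subr_eq0 -scalerBl scaler_eq0 oner_eq0 orbF.
by rewrite subr_eq0 => /eqP.
Qed.

Lemma comp0M (x y : A) : pr 0%N (x * y) = pr 0%N x * pr 0%N y.
Proof.
have key i j : pr 0%N (pr i x * pr j y)
    = (if i == 0%N then pr i x else 0) * (if j == 0%N then pr j y else 0).
  have hxy := cg_homM (homog_comp (cg_gr A) i x) (homog_comp (cg_gr A) j y).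
  case: eqP hxy => [->|/eqP ni]; last first.
    move=> hxy; rewrite mul0r (comp_homog hxy) //.
    by case: i ni {hxy}.
  case: eqP => [-> //|/eqP nj] hxy; rewrite mulr0 (comp_homog hxy) //.
  by case: j nj {hxy}.
have red (z : A) s : z = \sum_(i <- s) pr i z ->
    pr 0%N z = \sum_(i <- s) (if i == 0%N then pr i z else 0).
  move=> zE; rewrite {1}zE raddf_sum; apply: eq_bigr => i _ /=.
  by rewrite comp_comp eq_sym.
have [s _ xE] := comp_sum (cg_gr A) x.
have [t _ yE] := comp_sum (cg_gr A) y.
rewrite (red x s xE) (red y t yE) {1}xE {1}yE !mulr_suml raddf_sum.
apply: eq_bigr => i _ /=; rewrite !mulr_sumr raddf_sum.
by apply: eq_bigr => j _ /=; apply: key.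
Qed.

Lemma augmD : {morph augm : x y / x + y}.
Proof.
move=> x y; apply: scalarA_inj.
by rewrite -augmE raddfD /= !augmE scalerDl.
Qed.

Lemma augmM : {morph augm : x y / x * y}.
Proof.
move=> x y; apply: scalarA_inj.
by rewrite -augmE comp0M !augmE -scalerAl mul1r scalerA.
Qed.

Lemma augm1 : augm 1 = 1.
Proof.
apply: scalarA_inj; rewrite -augmE scale1r.
by have := scalar_homog 1; rewrite scale1r.
Qed.

Lemma augm_homog_gt0 i x : homog (cg_gr A) i x -> i != 0%N -> augm x = 0.
Proof.
move=> hx ni; apply: scalarA_inj; rewrite -augmE scale0r (comp_homog hx) //.
by rewrite eq_sym.
Qed.

Definition generated_deg1 : Prop :=
  forall S : {pred A}, GRing.subalg_closed S ->
    (forall x, homog (cg_gr A) 1%N x -> x \in S) -> forall x, x \in S.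

End CgAlgTheory.

Section RingNotions.

Definition fin_gen_sub (R : nzRingType) (M : lmodType R) (S : {pred M}) : Prop :=
  exists s : seq M, forall x, x \in S <->
    exists c : nat -> R, x = \sum_(i < size s) c i *: s`_i.

Definition left_noetherian (R : nzRingType) : Prop :=
  forall S : {pred R^o}, GRing.submod_closed S -> fin_gen_sub S.

(* Left ideals of the converse ring R^c are right ideals of R.                  *)
Definition noetherian (R : nzRingType) : Prop :=
  left_noetherian R /\ left_noetherian R^c.

Variable R : nzRingType.

Definition surj (U V : Type) (f : U -> V) : Prop := forall y, exists x, f x = y.

Definition exact (U V W : lmodType R) (f : U -> V) (g : V -> W) : Prop :=
  forall y, g y = 0 <-> exists x, f x = y.

Definition projective (P : lmodType R) : Prop :=
  forall (M N : lmodType R) (g : {linear M -> N}) (f : {linear P -> N}),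
    surj g -> exists h : {linear P -> M}, forall x, g (h x) = f x.

Definition resolution (P : nat -> lmodType R)
    (d : forall i, {linear P i.+1 -> P i}) (M : lmodType R)
    (e : {linear P 0%N -> M}) : Prop :=
  [/\ surj e, exact (d 0%N) e & forall i, exact (d i.+1) (d i)].

Definition pdim_le (M : lmodType R) (n : nat) : Prop :=
  exists (P : nat -> lmodType R) (d : forall i, {linear P i.+1 -> P i})
    (e : {linear P 0%N -> M}),
    [/\ resolution d e, forall i, projective (P i)
      & forall i, (n < i)%N -> forall x : P i, x = 0].

(* Left global dimension; it equals the right global dimension for noetherian   *)
(* rings (Auslander) and for connected graded algebras.                         *)
Definition finite_gldim : Prop :=
  exists n, forall M : lmodType R, pdim_le M n.

End RingNotions.

Section FiniteMap.
Variables (k : fieldType) (T A : cgalg k) (phi : {lrmorphism T -> A}).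

Definition graded_map : Prop :=
  forall i x, homog (cg_gr T) i x -> homog (cg_gr A) i (phi x).

Definition finite_map : Prop :=
  (exists s : seq A, forall a : A, exists c : nat -> T,
      a = \sum_(i < size s) phi (c i) * s`_i) /\
  (exists s : seq A, forall a : A, exists c : nat -> T,
      a = \sum_(i < size s) s`_i * phi (c i)).

End FiniteMap.

Section Veronese.
Variables (k : fieldType) (A : cgalg k) (d : nat).
Local Notation pr := (comp (cg_gr A)).

Definition ver_pred : {pred A} :=
  [pred x | `[< forall i, ~~ (d %| i)%N -> pr i x = 0 >]].

Lemma ver_predP x :
  reflect (forall i, ~~ (d %| i)%N -> pr i x = 0) (x \in ver_pred).
Proof. exact: asboolP. Qed.

Lemma ver_pred_subalg : GRing.subalg_closed ver_pred.
Proof.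
split.
- apply/ver_predP => i ni; have := scalar_homog A 1; rewrite scale1r => h1.
  by rewrite (comp_homog h1) //; apply: contraNneq ni => ->; apply: dvdn0.
- move=> a u v /ver_predP hu /ver_predP hv; apply/ver_predP => i ni.
  by rewrite raddfD /= compZ hu // hv // scaler0 addr0.
move=> u v /ver_predP hu /ver_predP hv; apply/ver_predP => n nn.
have [s _ uE] := comp_sum (cg_gr A) u; have [t _ vE] := comp_sum (cg_gr A) v.
rewrite uE vE mulr_suml raddf_sum big1 // => i _ /=.
rewrite mulr_sumr raddf_sum big1 // => j _ /=.
have hij := cg_homM (homog_comp (cg_gr A) i u) (homog_comp (cg_gr A) j v).
have [E|ne] := eqVneq n (i + j)%N; last by rewrite (comp_homog hij).
have [di|di] := boolP (d %| i)%N; last by rewrite hu // mul0r raddf0.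
rewrite hv ?mulr0 ?raddf0 //; apply: contra nn => dj.
by rewrite E dvdn_add.
Qed.

Definition ver_type : Type := {x : A | x \in ver_pred}.
HB.instance Definition _ := SubChoice.on ver_type.
HB.instance Definition _ := GRing.isSubalgClosed.Build k A ver_pred
  (GRing.subalg_closed_semi ver_pred_subalg).
HB.instance Definition _ := [SubChoice_isSubAlgebra of ver_type by <:].

Hypothesis d_gt1 : (1 < d)%N.

Lemma ver_comp_subproof i (x : ver_type) : pr (d * i)%N (val x) \in ver_pred.
Proof.
apply/ver_predP => j nj; rewrite comp_comp; case: eqP nj => // ->.
by rewrite dvdn_mulr.
Qed.

Definition ver_comp i (x : ver_type) : ver_type :=
  Sub (pr (d * i)%N (val x)) (ver_comp_subproof i x).

Lemma ver_comp_additive i : zmod_morphism (ver_comp i).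
Proof. by move=> x y; apply: val_inj; rewrite /= !raddfB. Qed.

HB.instance Definition _ i :=
  GRing.isZmodMorphism.Build ver_type ver_type (ver_comp i) (ver_comp_additive i).

Lemma ver_comp_comp i j x :
  ver_comp i (ver_comp j x) = if i == j then ver_comp j x else 0.
Proof.
apply: val_inj; rewrite /= comp_comp eqn_pmul2l ?(ltnW d_gt1) //.
by case: eqP.
Qed.

Lemma ver_comp_sum x :
  exists2 s : seq nat, uniq s & x = \sum_(i <- s) ver_comp i x.
Proof.
have [s us xE] := comp_sum (cg_gr A) (val x).
exists [seq (i %/ d)%N | i <- s & (d %| i)%N].
  rewrite map_inj_in_uniq ?filter_uniq // => i j.
  rewrite !mem_filter => /andP[di _] /andP[dj _] E.
  by rewrite -(divnK di) -(divnK dj) E.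
apply: val_inj; rewrite raddf_sum /= big_map big_filter {1}xE.
rewrite (bigID (fun i => d %| i)%N) /= [X in _ + X]big1 ?addr0; last first.
  by move=> i; apply/ver_predP; apply: (valP x).
by apply: eq_bigr => i di; rewrite mulnC divnK.
Qed.

Definition ver_gr : grading nat ver_type :=
  @Grading nat ver_type (fun i => ver_comp i) ver_comp_comp ver_comp_sum.

Lemma ver_homogE i x : homog ver_gr i x <-> homog (cg_gr A) (d * i)%N (val x).
Proof.
by split=> [/(congr1 val) //|h]; apply: val_inj.
Qed.

Lemma ver_homM i j x y :
  homog ver_gr i x -> homog ver_gr j y -> homog ver_gr (i + j)%N (x * y).
Proof.
move=> /ver_homogE hx /ver_homogE hy; apply/ver_homogE.
by rewrite mulnDr; apply: cg_homM.
Qed.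

Lemma ver_hom0 x : homog ver_gr 0%N x <-> exists c : k, x = c%:A.
Proof.
split=> [/ver_homogE|[c ->]].
  rewrite muln0 => /cg_hom0[c xE]; exists c; exact: val_inj.
by apply/ver_homogE; rewrite muln0; apply: scalar_homog.
Qed.

(* The d-th Veronese subring, with A_(d * i) in degree i.                       *)
Definition veronese : cgalg k :=
  @CGAlg k ver_type ver_gr ver_homM ver_hom0.

End Veronese.

Record gmod (k : fieldType) (B : cgalg k) := GMod {
  gm_mod :> lmodType B;
  gm_gr : grading int gm_mod;
  gm_homZ : forall (i : nat) (n : int) (b : B) (x : gm_mod),
    homog (cg_gr B) i b -> homog gm_gr n x -> homog gm_gr (i%:Z + n) (b *: x) }.

Section TrivialModule.
Variables (k : fieldType) (B : cgalg k).

Definition triv_type (C : cgalg k) : Type := k.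
Local Notation K := (triv_type B).
HB.instance Definition _ := GRing.Zmodule.on K.

Definition triv_scale (b : B) (x : K) : K := augm b * (x : k).

Lemma triv_scaleA a b v : triv_scale a (triv_scale b v) = triv_scale (a * b) v.
Proof. by rewrite /triv_scale augmM mulrA. Qed.
Lemma triv_scale1 : left_id 1 triv_scale.
Proof. by move=> v; rewrite /triv_scale augm1 mul1r. Qed.
Lemma triv_scaleDr : right_distributive triv_scale +%R.
Proof. by move=> a u v; apply: mulrDr. Qed.
Lemma triv_scaleDl v : {morph triv_scale^~ v : a b / a + b}.
Proof. by move=> a b; rewrite /triv_scale augmD mulrDl. Qed.

HB.instance Definition _ := GRing.Zmodule_isLmodule.Build B K
  triv_scaleA triv_scale1 triv_scaleDr triv_scaleDl.

Definition triv_comp (n : int) (x : K) : K := if n == 0 then x else 0.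

Lemma triv_comp_additive n : zmod_morphism (triv_comp n).
Proof. by move=> x y; rewrite /triv_comp; case: eqP => // _; rewrite subr0. Qed.
HB.instance Definition _ n :=
  GRing.isZmodMorphism.Build K K (triv_comp n) (triv_comp_additive n).

Lemma triv_comp_comp i j x :
  triv_comp i (triv_comp j x) = if i == j then triv_comp j x else 0.
Proof.
rewrite /triv_comp; have [->|ni] := eqVneq i j; first by case: eqP.
have [i0|//] := eqVneq i 0; have [j0|//] := eqVneq j 0.
by move: ni; rewrite i0 j0 eqxx.
Qed.

Lemma triv_comp_sum x :
  exists2 s : seq int, uniq s & x = \sum_(i <- s) triv_comp i x.
Proof. by exists [:: 0] => //; rewrite big_seq1 /triv_comp eqxx. Qed.

Definition triv_gr : grading int K :=
  @Grading int K (fun n => triv_comp n) triv_comp_comp triv_comp_sum.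

Lemma triv_homZ (i : nat) (n : int) (b : B) (x : K) :
  homog (cg_gr B) i b -> homog triv_gr n x -> homog triv_gr (i%:Z + n) (b *: x).
Proof.
rewrite /homog /= => hb hx.
have [i0|ni] := eqVneq i 0%N; last first.
  have -> : b *: x = 0 :> K.
    by apply: etrans (mul0r (x : k)); congr (_ * _); apply: augm_homog_gt0 hb ni.
  by rewrite /triv_comp; case: ifP.
move: hx; rewrite i0 add0r /triv_comp; case: ifP => // _ <-.
by rewrite scaler0.
Qed.

(* The trivial module k = B / B_{>= 1}.                                         *)
Definition triv_mod : gmod B := @GMod k B K triv_gr triv_homZ.

End TrivialModule.

Section Koszul.
Variables (k : fieldType) (B : cgalg k).

Definition deg0_map (M N : gmod B) (f : M -> N) : Prop :=
  forall n x, homog (gm_gr M) n x -> homog (gm_gr N) n (f x).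

Definition graded_free (F : gmod B) : Prop :=
  exists (I : choiceType) (e : I -> F) (deg : I -> int),
    [/\ forall i, homog (gm_gr F) (deg i) (e i),
        forall x, exists (s : seq I) (c : I -> B), x = \sum_(i <- s) c i *: e i
      & forall (s : seq I) (c : I -> B), uniq s ->
          \sum_(i <- s) c i *: e i = 0 -> forall i, i \in s -> c i = 0].

Definition graded_free_resolution (P : nat -> gmod B)
    (d : forall i, {linear P i.+1 -> P i})
    (e : {linear P 0%N -> triv_mod B}) : Prop :=
  [/\ resolution d e, forall i, graded_free (P i),
      forall i, deg0_map (d i) & deg0_map e].

(* x lies in B_{>= 1} M, i.e. its class in k (x)_B M = M / B_{>= 1} M is 0.     *)
Definition in_augM (M : gmod B) (x : M) : Prop :=
  exists s : seq (B * M), (forall p, p \in s -> augm p.1 = 0) /\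
    x = \sum_(p <- s) p.1 *: p.2.

(* The class of x in k (x)_B P_i is a cycle, resp. a boundary, of k (x)_B P.    *)
Definition tor_cycle (P : nat -> gmod B) (d : forall i, {linear P i.+1 -> P i})
    (i : nat) : P i -> Prop :=
  match i with 0%N => fun _ => True | i'.+1 => fun x => in_augM (d i' x) end.

Definition tor_boundary (P : nat -> gmod B)
    (d : forall i, {linear P i.+1 -> P i}) (i : nat) (x : P i) : Prop :=
  exists y : P i.+1, in_augM (x - d i y).

(* Tor^B_i(k, k)_j = 0: the degree j part of H_i(k (x)_B P) vanishes for a      *)
(* graded free resolution P of the left module k; P may be any such resolution, *)
(* since Tor does not depend on it.                                             *)
Definition Tor_kk_eq0 (i : nat) (j : int) : Prop :=
  exists (P : nat -> gmod B) (d : forall i, {linear P i.+1 -> P i})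
    (e : {linear P 0%N -> triv_mod B}),
    graded_free_resolution d e /\
    forall x : P i, homog (gm_gr (P i)) j x -> tor_cycle d x ->
      tor_boundary d x.

Definition koszul : Prop :=
  forall (i : nat) (j : int), j != i%:Z -> Tor_kk_eq0 i j.

End Koszul.

(* Main.v *)
From HB Require Import structures.
From mathcomp Require Import all_boot all_order all_algebra.
From mathcomp Require Import boolp.
Require Import Defs.

(* Over T, finite global dimension and noetherianity give every finitely
   generated graded module M a regularity: an r such that M has a projective
   resolution by finitely generated modules generated in degrees <= r. Let rA
   be the regularity of A over T. If an A-module Z has T-regularity <= r, then
   it has a finite free cover over A with generators in degrees <= r, whose
   kernel has T-regularity <= r + rA. So the A-syzygies of k have degrees
   growing at most linearly.

   Let B = A^(d) and let M |-> V_t M = \bigoplus_q M_(dq + t) be the Veronese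
   functors from A-modules to B-modules. By induction on n, V_t A has a
   resolution over B that is linear up to stage n. When d does not divide t,
   V_t k = 0, so V_t A = V_t A_(>= 1) is covered by copies of V_(t - 1) A, and
   for d large the kernel V_t Z, Z the second syzygy of k, is resolved by
   modules V_s A generated in low enough degrees. The same argument, applied to
   V_0 of a free resolution of k, makes the trivial B-module linear. *)

Set Implicit Arguments.
Unset Strict Implicit.
Unset Printing Implicit Defensive.

Import Order.TTheory GRing.Theory Num.Theory.
Local Open Scope ring_scope.

(** * Submodules and projective dimension *)

Definition mklin (R : nzRingType) (M N : lmodType R) (f : M -> N)
    (fl : linear f) : {linear M -> N} :=
  HB.pack f (GRing.isLinear.Build R M N _ f fl).

Section Submodule.
Variables (R : nzRingType) (M : lmodType R) (S : {pred M}).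
Hypothesis hS : GRing.submod_closed S.
(** The closure proof is a phantom argument: it lets the submodule structure be inferred from the
    predicate. *)
Definition submod_pred of GRing.submod_closed S : {pred M} := S.
HB.instance Definition _ := GRing.isSubmodClosed.Build R M (submod_pred hS)
  (GRing.submod_closed_semi hS).
Definition submod : Type := {x : M | x \in submod_pred hS}.
HB.instance Definition _ := SubChoice.on submod.
HB.instance Definition _ := [SubChoice_isSubLmodule of submod by <:].
End Submodule.

Section Kernel.
Variables (R : nzRingType) (M N : lmodType R) (f : {linear M -> N}).

Lemma ker_submod_closed : GRing.submod_closed [pred x | f x == 0].
Proof.
split=> [|a u v]; rewrite !inE ?linear0 // => /eqP hu /eqP hv.
by rewrite linearP /= hu hv scaler0 addr0.
Qed.

Definition kermod : lmodType R := submod ker_submod_closed.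
(* Locked, because /= would otherwise unfold kerval to the raw projection. *)
Fact kerval_key : unit. Proof. by []. Qed.
Definition kerval : {linear kermod -> M} :=
  locked_with kerval_key (val : {linear kermod -> M}).

Lemma kervalE x : kerval x = val x.
Proof. by rewrite /kerval unlock. Qed.

Lemma kerval_inj : injective kerval.
Proof. by move=> x y; rewrite !kervalE; apply: val_inj. Qed.

Lemma exact_kerval : exact kerval f.
Proof.
move=> y; split=> [fy0|[x <-]]; last first.
  by rewrite kervalE; exact/eqP/(valP x).
have yker : y \in submod_pred ker_submod_closed by rewrite inE; apply/eqP.
by exists (Sub y yker); rewrite kervalE.
Qed.
End Kernel.

(** Preimages are chosen pointwise, and linearity can be checked after applying the injective [i].
    All maps into kernels and pullbacks are obtained this way. *)
Lemma linear_factor (R : nzRingType) (K F X : lmodType R)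
    (i : {linear K -> F}) (f : {linear X -> F}) :
  injective i -> (forall x, exists y, i y = f x) ->
  exists g : {linear X -> K}, forall x, i (g x) = f x.
Proof.
move=> ii ex; pose g x := sval (cid (ex x)).
have gE x : i (g x) = f x by rewrite /g; case: cid.
have gl : linear g by move=> a u v; apply: ii; rewrite linearP !gE linearP.
by exists (mklin gl).
Qed.

Section Projective.
Variable R : nzRingType.
Implicit Types F K M N P Q X Om : lmodType R.

Lemma inj_eq0 M N (i : {linear M -> N}) :
  (forall x, i x = 0 -> x = 0) -> injective i.
Proof.
by move=> i0 x y xy; apply/eqP; rewrite -subr_eq0; apply/eqP/i0;
  rewrite linearB /= xy subrr.
Qed.

Lemma exact_comp0 M N P (f : {linear M -> N}) (g : {linear N -> P}) :
  exact f g -> forall x, g (f x) = 0.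
Proof. by move=> ex x; apply/ex; exists x. Qed.

Lemma projective_retract P M (i : {linear M -> P}) (r : {linear P -> M}) :
  (forall x, r (i x) = x) -> projective P -> projective M.
Proof.
move=> ri pP X Y g f gs; have [h hE] := pP X Y g (f \o r)%FUN gs.
by exists (h \o i)%FUN => x /=; rewrite hE /= ri.
Qed.

Lemma projective_pair P Q : projective P -> projective Q ->
  projective (P * Q)%type.
Proof.
move=> pP pQ X Y g f gs.
have l1 : linear (fun x : P => (x, 0 : Q)).
  by move=> a u v; apply: injective_projections; rewrite /= ?scaler0 ?addr0.
have l2 : linear (fun x : Q => (0 : P, x)).
  by move=> a u v; apply: injective_projections; rewrite /= ?scaler0 ?addr0.
have [h1 h1E] := pP X Y g (f \o mklin l1)%FUN gs.
have [h2 h2E] := pQ X Y g (f \o mklin l2)%FUN gs.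
have hl : linear (fun x : P * Q => h1 x.1 + h2 x.2).
  by move=> a u v; rewrite !linearP /= scalerDr addrACA.
exists (mklin hl) => -[x y] /=; rewrite raddfD /= h1E h2E /= -raddfD.
by congr (f _); apply: injective_projections; rewrite /= ?addr0 ?add0r.
Qed.

(* A section s of q makes p : X -> M, x |-> i^{-1} (x - s (q x)), a retraction. *)
Lemma ses_retraction M X Q (i : {linear M -> X}) (q : {linear X -> Q})
    (s : {linear Q -> X}) :
  injective i -> exact i q -> (forall y, q (s y) = y) ->
  exists r : {linear X -> M},
    (forall x, i (r x) = x - s (q x)) /\ (forall x, r (i x) = x).
Proof.
move=> ii ex qs.
have fl : linear (fun x => x - s (q x)).
  by move=> a u v; rewrite (linearP q) (linearP s) scalerBr opprD addrACA.
have [|r rE] := @linear_factor R M X X i (mklin fl) ii.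
  by move=> x /=; apply/ex; rewrite linearB /= qs subrr.
exists r; split=> x; first exact: rE.
by apply: ii; rewrite rE /= (exact_comp0 ex) linear0 subr0.
Qed.

Lemma projective_split M Q (q : {linear M -> Q}) : projective Q -> surj q ->
  exists s : {linear Q -> M}, forall y, q (s y) = y.
Proof. by move=> pQ qs; have [s sE] := pQ _ _ q idfun qs; exists s. Qed.

(** The sequence splits, so X is M (+) Q, and projectivity passes to summands and to sums. *)
Lemma projective_ses M X Q (i : {linear M -> X}) (q : {linear X -> Q}) :
  injective i -> exact i q -> surj q -> projective Q ->
  projective X <-> projective M.
Proof.
move=> ii ex qs pQ; have [s sE] := projective_split pQ qs.
have [r [ir ri]] := ses_retraction ii ex sE.
split=> [pX|pM]; first exact: projective_retract ri pX.
have l1 : linear (fun x => (r x, q x)) by move=> a u v; rewrite !linearP.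
have l2 : linear (fun x : M * Q => i x.1 + s x.2).
  by move=> a u v; rewrite !linearP /= scalerDr addrACA.
apply: (@projective_retract (M * Q)%type _ (mklin l1) (mklin l2)).
  by move=> x /=; rewrite ir subrK.
exact: projective_pair.
Qed.

(** Recursive form of [pdim_le], peeling off one syzygy at a time, as the inductions below need. *)
Fixpoint proj_dim_le (n : nat) (M : lmodType R) : Prop :=
  if n is n'.+1 then
    exists (P K : lmodType R) (i : {linear K -> P}) (p : {linear P -> M}),
      [/\ projective P, injective i, exact i p, surj p & proj_dim_le n' K]
  else projective M.

Lemma proj_dim_le_iso n M N (f : {linear M -> N}) :
  injective f -> surj f -> proj_dim_le n M -> proj_dim_le n N.
Proof.
move=> fi fs; case: n => [|n] /=.
  have [|g gE] := @linear_factor R M N N f idfun fi; first exact: fs.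
  by apply: (@projective_retract M N g f) => x; apply: gE.
move=> [P [K [i [p [pP ii ex ps hK]]]]].
exists P, K, i, (f \o p)%FUN; split=> // y /=; last first.
  by have [x <-] := fs y; have [z <-] := ps x; exists z.
rewrite -ex; split=> [|->]; last exact: linear0.
by rewrite -(linear0 f); apply: fi.
Qed.

(** Since Q splits off, a cover of M plus Q covers X, and the part of a cover of X lying over M
    covers M. In both directions the kernel K stays the same. *)
Lemma proj_dim_le_ses n M X Q (i : {linear M -> X}) (q : {linear X -> Q}) :
  injective i -> exact i q -> surj q -> projective Q ->
  proj_dim_le n X <-> proj_dim_le n M.
Proof.
move=> ii ex qs pQ; case: n => [|n] /=; first exact: projective_ses ex qs pQ.
have [s sE] := projective_split pQ qs.
split=> -[P [K [j [p [pP ji jp ps hK]]]]]; last first.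
  have l1 : linear (fun x => (j x, 0 : Q)).
    by move=> a u v; apply: injective_projections;
      rewrite /= ?linearP ?scaler0 ?addr0.
  have l2 : linear (fun x : P * Q => i (p x.1) + s x.2).
    by move=> a u v; rewrite !linearP /= scalerDr addrACA.
  exists (P * Q)%type, K, (mklin l1), (mklin l2); split => //=.
  - exact: projective_pair.
  - by move=> x y [] /ji.
  - move=> [x y] /=; split=> [xy0|[z [<- <-]]]; last first.
      by rewrite (exact_comp0 jp) !linear0 addr0.
    have /(congr1 q) := xy0; rewrite linearD /= (exact_comp0 ex) sE add0r.
    rewrite linear0 => y0; move: xy0; rewrite y0 linear0 addr0.
    rewrite -(linear0 i) => /ii /jp [z <-]; by exists z.
  move=> x; have [r [ir _]] := ses_retraction ii ex sE.
  have [z zE] := ps (r x); exists (z, q x) => /=.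
  by rewrite zE ir subrK.
(* The kernel P' of P -> Q is the part of P lying over M; it is projective because Q is. *)
have qps : surj (q \o p)%FUN.
  by move=> y; have [x <-] := qs y; have [z <-] := ps x; exists z.
pose P' := kermod (q \o p)%FUN; pose v := kerval (q \o p)%FUN.
have vi : injective v by apply: kerval_inj.
have pP' : projective P'.
  by apply/(projective_ses vi (@exact_kerval _ _ _ _) qps pQ).
have [|j' jE] := @linear_factor R P' P K v j vi.
  move=> x; apply/exact_kerval => /=.
  by rewrite (exact_comp0 jp) linear0.
have [|p' pE] := @linear_factor R M X P' i (p \o v)%FUN ii.
  by move=> x; apply/ex/(exact_kerval (q \o p)%FUN); exists x.
exists P', K, j', p'; split=> //.
- by move=> x y /(congr1 v); rewrite !jE => /ji.
- move=> y; split=> [y0|[x <-]].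
    have := pE y; rewrite y0 linear0 /= => /esym/jp[x xE].
    by exists x; apply: vi; rewrite -xE jE.
  by apply: ii; rewrite pE /= jE linear0 (exact_comp0 jp).
move=> y; have [x xE] := ps (i y).
have [|z zE] := (exact_kerval (q \o p)%FUN x).1.
  by rewrite /= xE (exact_comp0 ex).
by exists z; apply: ii; rewrite pE /= [v z]zE.
Qed.

(* Schanuel: both kernels are stably isomorphic to the pullback of P and F. *)
Lemma proj_dim_le_ker n M F Om (i : {linear Om -> F}) (p : {linear F -> M}) :
  projective F -> injective i -> exact i p -> surj p ->
  proj_dim_le n.+1 M -> proj_dim_le n Om.
Proof.
move=> pF ii ex ps [P [K [j [q [pP ji jq qs hK]]]]].
have wl : linear (fun x : P * F => q x.1 - p x.2).
  by move=> a u v; rewrite (linearP q) (linearP p) scalerBr opprD addrACA.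
pose W := kermod (mklin wl); pose v := kerval (mklin wl).
have vi : injective v by apply: kerval_inj.
have vE z : q (v z).1 = p (v z).2.
  apply/eqP; rewrite -subr_eq0.
  by apply/eqP/(exact_kerval (mklin wl)); exists z.
have Wof x y : q x = p y -> exists z, v z = (x, y).
  by move=> xy; apply/(exact_kerval (mklin wl)); rewrite /= xy subrr.
have l1 : linear (fun x => (j x, 0 : F)).
  by move=> a u w; apply: injective_projections;
    rewrite /= ?linearP ?scaler0 ?addr0.
have l2 : linear (fun x => (0 : P, i x)).
  by move=> a u w; apply: injective_projections;
    rewrite /= ?linearP ?scaler0 ?addr0.
have [|j' jE] := @linear_factor R W _ _ v (mklin l1) vi.
  by move=> x; apply: Wof; rewrite (exact_comp0 jq) linear0.
have [|i' iE] := @linear_factor R W _ _ v (mklin l2) vi.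
  by move=> x; apply: Wof; rewrite (exact_comp0 ex) linear0.
have a1 : linear (fun z => (v z).1) by move=> a u w; rewrite linearP.
have a2 : linear (fun z => (v z).2) by move=> a u w; rewrite linearP.
(* Over F the pullback W has kernel K, which bounds its dimension; over P it has kernel Om, to which
   the bound then descends. *)
have hW : proj_dim_le n W.
  apply/(@proj_dim_le_ses n K W F j' (mklin a2)) => //=.
  - by move=> x y /(congr1 v); rewrite !jE => -[] /ji.
  - move=> z /=; split=> [z0|[x <-]]; last by rewrite jE.
    have /jq[x xE] : q (v z).1 = 0 by rewrite vE z0 linear0.
    by exists x; apply: vi; rewrite [LHS]jE [RHS]surjective_pairing -xE z0.
  move=> y; have [x xE] := qs (p y); have [z zE] := Wof x y xE.
  by exists z; rewrite zE.
apply/(@proj_dim_le_ses n Om W P i' (mklin a1)) => //=.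
- by move=> x y /(congr1 v); rewrite !iE => -[] /ii.
- move=> z /=; split=> [z0|[x <-]]; last by rewrite iE.
  have /ex[x xE] : p (v z).2 = 0 by rewrite -vE z0 linear0.
  by exists x; apply: vi; rewrite [LHS]iE [RHS]surjective_pairing -xE z0.
move=> y; have [x xE] := ps (q y); have [z zE] := Wof y x (esym xE).
by exists z; rewrite zE.
Qed.

(** Without its first term, a resolution of M resolves the kernel of the augmentation; this is the
    induction step. *)
Lemma pdim_leW n M : pdim_le M n -> proj_dim_le n M.
Proof.
move=> [P [d [e [[es ex0 exS] pP P0]]]].
elim: n M P d e es ex0 exS pP P0 => [|n IHn] M P d e es ex0 exS pP P0.
  (* At n = 0 the term P_1 is zero, so [e] is injective and M is isomorphic to P_0. *)
  apply: (@proj_dim_le_iso 0 (P 0%N) M e) => //=; apply: inj_eq0.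
  by move=> x /ex0[y <-]; have -> : y = 0 by [apply: P0]; rewrite linear0.
have [|e' eE] := @linear_factor R (kermod e) (P 0%N) (P 1%N) (kerval e) (d 0%N)
  (@kerval_inj _ _ _ _).
  by move=> x; apply/exact_kerval/ex0; exists x.
exists (P 0%N), (kermod e), (kerval e), e; split=> //.
- exact: kerval_inj.
- exact: exact_kerval.
apply: (IHn _ (fun i => P i.+1) (fun i => d i.+1) e') => //; last first.
  by move=> i ni; apply: P0.
- move=> y; rewrite -exS -eE; split=> [->|]; first exact: linear0.
  by rewrite -(linear0 (kerval e)) => /kerval_inj.
move=> y; have [|x xE] := (ex0 (kerval e y)).1.
  by apply: (exact_comp0 (@exact_kerval _ _ _ e)).
by exists x; apply: kerval_inj; rewrite eE.
Qed.

End Projective.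

(** * Finitely generated modules *)

Section FinGen.
Variable R : nzRingType.
Implicit Types K M N X : lmodType R.

Definition row_comb M m (x : 'I_m -> M) (v : 'rV[R]_m) : M :=
  \sum_j v 0 j *: x j.

Lemma row_comb_linear M m (x : 'I_m -> M) : linear (row_comb x).
Proof.
move=> a u v; rewrite scaler_sumr -big_split; apply: eq_bigr => j _.
by rewrite !mxE scalerDl scalerA.
Qed.

Definition row_map M m (x : 'I_m -> M) : {linear 'rV[R]_m -> M} :=
  mklin (row_comb_linear x).

Lemma row_mapE M m (x : 'I_m -> M) v : row_map x v = \sum_j v 0 j *: x j.
Proof. by []. Qed.

Lemma row_map_delta M m (x : 'I_m -> M) j : row_map x (delta_mx 0 j) = x j.
Proof.
rewrite row_mapE (bigD1 j) //= big1 ?addr0 => [|i ni]; rewrite mxE eqxx /=.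
  by rewrite eqxx scale1r.
by rewrite (negbTE ni) scale0r.
Qed.

Lemma row_map_eq M m (f : {linear 'rV[R]_m -> M}) v :
  f v = \sum_j v 0 j *: f (delta_mx 0 j).
Proof.
by rewrite {1}(row_sum_delta v) linear_sum; apply: eq_bigr => j _;
  rewrite linearZ.
Qed.

Definition fin_gen M : Prop :=
  exists m (f : {linear 'rV[R]_m -> M}), surj f.

(** Finitely many elements of Y already express the finitely many generators. With Y a homogeneity
    condition, this gives homogeneous generators, even in a prescribed degree. *)
Lemma fin_gen_span M (Y : M -> Prop) : fin_gen M ->
  (forall x, exists s : seq (R * M),
     (forall p, p \in s -> Y p.2) /\ x = \sum_(p <- s) p.1 *: p.2) ->
  exists m (y : 'I_m -> M), (forall j, Y (y j)) /\ surj (row_map y).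
Proof.
move=> [m [f fs]] ex; pose s j := sval (cid (ex (f (delta_mx 0 j)))).
have sY j : forall p, p \in s j -> Y p.2 by rewrite /s; case: cid => t [].
have sE j : f (delta_mx 0 j) = \sum_(p <- s j) p.1 *: p.2.
  by rewrite /s; case: cid => t [].
pose L := flatten [seq s j | j : 'I_m].
have LP p : p \in L -> exists j, p \in s j.
  by move=> /flattenP[t /imageP[j _ ->]]; exists j.
pose y (l : 'I_(size L)) := (nth (0, 0) L l).2.
exists (size L), y; split=> [l|x].
  by have [j] := LP _ (mem_nth (0, 0) (ltn_ord l)); apply: sY.
have yp j p : p \in s j -> exists v, row_map y v = p.2.
  move=> ps; have Lp : p \in L.
    by apply/flattenP; exists (s j); rewrite ?image_f.
  have lt : (index p L < size L)%N by rewrite index_mem.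
  by exists (delta_mx 0 (Ordinal lt)); rewrite row_map_delta /y /= nth_index.
have yf j : exists v, row_map y v = f (delta_mx 0 j).
  rewrite sE; elim: (s j) (@yp j) => [|p t IHt] h.
    by exists 0; rewrite linear0 big_nil.
  have [|u uE] := IHt; first by move=> q qt; apply: h; rewrite inE qt orbT.
  have [|v vE] := h p; first by rewrite inE eqxx.
  by exists (p.1 *: v + u); rewrite big_cons [LHS]linearP uE vE.
have [v <-] := fs x; rewrite row_map_eq.
pose u j := sval (cid (yf j)).
exists (\sum_j v 0 j *: u j); rewrite linear_sum; apply: eq_bigr => j _.
by rewrite linearZ /u; case: cid => w /= ->.
Qed.

Lemma rV_projective m : projective ('rV[R]_m : lmodType R).
Proof.
move=> M N g h gs; pose x j := sval (cid (gs (h (delta_mx 0 j)))).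
exists (row_map x) => v; rewrite [RHS]row_map_eq row_mapE linear_sum.
by apply: eq_bigr => j _; rewrite linearZ /x; case: cid => z /= ->.
Qed.

Lemma fin_gen_ext K X N b (i : {linear K -> X}) (q : {linear X -> N})
    (g : {linear 'rV[R]_b -> X}) :
  exact i q -> fin_gen K -> (forall x, exists v, q (g v) = q x) -> fin_gen X.
Proof.
move=> ex [a [f fs]] gs.
have fl : linear (fun v : 'rV[R]_(a + b) => i (f (lsubmx v)) + g (rsubmx v)).
  by move=> c u v; rewrite !linearP /= scalerDr addrACA.
exists (a + b)%N, (mklin fl) => x /=.
have [v vE] := gs x; have [|z zE] := (ex (x - g v)).1.
  by rewrite linearB vE subrr.
have [w wE] := fs z; exists (row_mx w v).
by rewrite row_mxKl row_mxKr wE zE subrK.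
Qed.

(** Induction on m through the first coordinate [q]: its image is a left ideal, and its kernel
    embeds in the remaining coordinates. *)
Lemma noetherian_rV m X (i : {linear X -> 'rV[R]_m}) :
  left_noetherian R -> injective i -> fin_gen X.
Proof.
move=> nR; elim: m X i => [|m IHm] X i ii.
  have fl : linear (fun _ : 'rV[R]_0 => 0 : X).
    by move=> a u v; rewrite scaler0 addr0.
  by exists 0%N, (mklin fl) => x; exists 0; apply: ii; apply/rowP => -[].
have ql : linear (fun x => i x 0 ord0 : R^o).
  by move=> a u v; rewrite linearP !mxE.
pose q : {linear X -> R^o} := mklin ql.
have jl : linear (fun z : kermod q => \row_j i (kerval q z) 0 (lift ord0 j)).
  by move=> a u v; apply/rowP => j; rewrite !(linearP, mxE).
have fgK : fin_gen (kermod q).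
  apply: (IHm _ (mklin jl)) => x y /rowP xy; apply/kerval_inj/ii/rowP => j.
  have q0 (z : kermod q) : i (kerval q z) 0 ord0 = 0.
    by apply: (@exact_comp0 _ _ _ _ _ _ (@exact_kerval _ _ _ q) z).
  case: (unliftP ord0 j) => [j' ->|->]; last by rewrite !q0.
  by have := xy j'; rewrite !mxE.
pose S : {pred R^o} := [pred y | `[< exists x, q x = y >]].
have Sc : GRing.submod_closed S.
  split=> [|a u v]; rewrite !inE.
    by apply/asboolP; exists 0; apply: linear0.
  move=> /asboolP[x <-] /asboolP[y <-]; apply/asboolP; exists (a *: x + y).
  exact: linearP.
have [s sE] := nR S Sc.
have sS (j : 'I_(size s)) : exists x, q x = s`_j.
  (* Indicator coefficients show that each generator of the ideal lies in it, hence has a preimage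
     under [q]. *)
  apply/asboolP/sE; exists (fun l => (l == val j)%:R).
  rewrite (bigD1 j) //= eqxx scale1r big1 ?addr0 // => l nl.
  by rewrite -(inj_eq val_inj) in nl; rewrite (negbTE nl) scale0r.
pose x_ j := sval (cid (sS j)).
apply: (@fin_gen_ext _ _ _ _ _ q (row_map x_) (@exact_kerval _ _ _ q) fgK).
move=> x; have /sE[c cE] : q x \in S by rewrite inE; apply/asboolP; exists x.
exists (\row_j c j); rewrite row_mapE linear_sum cE; apply: eq_bigr => j _.
by rewrite linearZ mxE /x_; case: cid => y /= <-.
Qed.

End FinGen.

(** * Gradings and graded modules *)

Section GradingTheory.
Variables (I : eqType) (V : zmodType) (g : grading I V).

Lemma comp_finite x : exists2 s : seq I, uniq s &
  forall i, i \notin s -> comp g i x = 0.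
Proof.
have [s us xE] := comp_sum g x; exists s => // i si.
rewrite xE raddf_sum big_seq big1 //= => j js; rewrite comp_comp.
by case: eqP => // ij; rewrite ij js in si.
Qed.

Lemma comp_ext x y : (forall i, comp g i x = comp g i y) -> x = y.
Proof.
move=> xy; apply/eqP; rewrite -subr_eq0; apply/eqP.
have [s _ ->] := comp_sum g (x - y).
by rewrite big1 // => i _; rewrite raddfB /= xy subrr.
Qed.

Lemma comp_sum_seq (s : seq I) (u : I -> V) j : uniq s ->
  comp g j (\sum_(i <- s) comp g i (u i)) =
  if j \in s then comp g j (u j) else 0.
Proof.
move=> us; rewrite raddf_sum /=; case: ifP => js.
  rewrite (bigD1_seq j) //= comp_comp eqxx big1 ?addr0 // => i ni.
  by rewrite comp_comp eq_sym (negbTE ni).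
rewrite big_seq big1 // => i si; rewrite comp_comp.
by case: eqP => // ji; rewrite ji si in js.
Qed.

Lemma comp_sumE (s : seq I) x : uniq s ->
  (forall i, i \notin s -> comp g i x = 0) -> x = \sum_(i <- s) comp g i x.
Proof.
move=> us s0; apply: comp_ext => j; rewrite (comp_sum_seq (fun=> x)) //.
by case: ifPn => // /s0.
Qed.

Lemma homog0 i : homog g i 0. Proof. exact: raddf0. Qed.

Lemma homog_sum i (J : Type) (s : seq J) (P : pred J) F :
  (forall j, P j -> homog g i (F j)) -> homog g i (\sum_(j <- s | P j) F j).
Proof. by move=> h; rewrite /homog raddf_sum; apply: eq_bigr. Qed.

End GradingTheory.

Section IntGrading.
Variables (V : zmodType) (g : grading nat V).

Definition int_comp (n : int) : {additive V -> V} :=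
  if n is Posz m then comp g m else \0.

Lemma int_comp_comp i j x :
  int_comp i (int_comp j x) = if i == j then int_comp j x else 0.
Proof.
case: i j => [i|i] [j|j] /=; rewrite ?raddf0 ?comp_comp //.
by case: ifP.
Qed.

Lemma int_comp_sum x :
  exists2 s : seq int, uniq s & x = \sum_(i <- s) int_comp i x.
Proof.
have [s us xE] := comp_sum g x; exists (map Posz s); last by rewrite big_map.
by rewrite map_inj_uniq // => i j [].
Qed.

Definition int_gr : grading int V := Grading int_comp_comp int_comp_sum.

End IntGrading.

Section ShiftGrading.
Variables (V : zmodType) (g : grading int V) (a : int).

Lemma shift_comp_comp i j x : comp g (i - a) (comp g (j - a) x) =
  if i == j then comp g (j - a) x else 0.
Proof. by rewrite comp_comp (inj_eq (addIr _)). Qed.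

Lemma shift_comp_sum x :
  exists2 s : seq int, uniq s & x = \sum_(i <- s) comp g (i - a) x.
Proof.
have [s us xE] := comp_sum g x; exists [seq i + a | i <- s].
  by rewrite map_inj_uniq //; apply: addIr.
by rewrite big_map {1}xE; apply: eq_bigr => i _; rewrite addrK.
Qed.

(** The twist usually written V(-a): an element of degree i moves to degree i + a. *)
Definition shift_gr : grading int V :=
  @Grading int V (fun i => comp g (i - a)) shift_comp_comp shift_comp_sum.

End ShiftGrading.

Section RowGrading.
Variables (R : nzRingType) (g : grading int R) (m : nat) (deg : 'I_m -> int).
Local Notation V := 'rV[R]_m.

(** The j-th basis vector gets degree [deg j], so its coefficient in degree n has degree n - deg j;
    the graded module obtained is the sum of the R(-deg j). *)
Definition row_comp (n : int) (v : V) : V :=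
  \row_j comp g (n - deg j) (v 0 j).

Lemma row_comp_additive n : zmod_morphism (row_comp n).
Proof. by move=> x y; apply/rowP => j; rewrite !mxE raddfB. Qed.
HB.instance Definition _ n :=
  GRing.isZmodMorphism.Build V V (row_comp n) (row_comp_additive n).

Lemma row_comp_comp i j x :
  row_comp i (row_comp j x) = if i == j then row_comp j x else 0.
Proof.
apply/rowP => l; rewrite !mxE comp_comp (inj_eq (addIr _)).
by case: eqP; rewrite mxE.
Qed.

Lemma row_comp_sum x :
  exists2 s : seq int, uniq s & x = \sum_(i <- s) row_comp i x.
Proof.
have fin j : exists s : seq int, forall i, i \notin s ->
    comp g (i - deg j) (x 0 j) = 0.
  by have [s _ sP] := comp_finite (shift_gr g (deg j)) (x 0 j); exists s.
pose t j := sval (cid (fin j)).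
pose s := undup (flatten [seq t j | j : 'I_m]).
exists s; first exact: undup_uniq.
apply/rowP => j; rewrite summxE.
rewrite [LHS](@comp_sumE _ _ (shift_gr g (deg j)) s _ (undup_uniq _)).
  by apply: eq_bigr => i _; rewrite mxE.
move=> i si; apply: (svalP (cid (fin j))); apply: contra si => si.
by rewrite mem_undup; apply/flattenP; exists (t j) => //; apply: image_f.
Qed.

Definition row_gr : grading int V :=
  @Grading int V (fun n => row_comp n) row_comp_comp row_comp_sum.

Lemma row_homogP n v : homog row_gr n v <->
  forall j, homog g (n - deg j) (v 0 j).
Proof.
split=> [h j|h].
  by rewrite -[in X in homog _ _ X]h mxE; apply: homog_comp.
by apply/rowP => j; rewrite mxE; apply: h.
Qed.

End RowGrading.

Section PairGrading.
Variables (V W : zmodType) (g : grading int V) (h : grading int W).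

Definition pair_comp (n : int) (x : V * W) : V * W :=
  (comp g n x.1, comp h n x.2).

Lemma pair_comp_additive n : zmod_morphism (pair_comp n).
Proof. by move=> x y; rewrite /pair_comp !raddfB. Qed.
HB.instance Definition _ n :=
  GRing.isZmodMorphism.Build (V * W)%type (V * W)%type (pair_comp n)
    (pair_comp_additive n).

Lemma pair_comp_comp i j x :
  pair_comp i (pair_comp j x) = if i == j then pair_comp j x else 0.
Proof. by rewrite /pair_comp /= !comp_comp; case: eqP. Qed.

Lemma pair_comp_sum x :
  exists2 s : seq int, uniq s & x = \sum_(i <- s) pair_comp i x.
Proof.
have [s _ sP] := comp_finite g x.1; have [t _ tP] := comp_finite h x.2.
exists (undup (s ++ t)); first exact: undup_uniq.
apply: injective_projections; rewrite raddf_sum /=;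
  apply: comp_sumE; rewrite ?undup_uniq // => i;
  by rewrite mem_undup mem_cat negb_or => /andP[? ?]; auto.
Qed.

Definition pair_gr : grading int (V * W)%type :=
  @Grading int _ (fun n => pair_comp n) pair_comp_comp pair_comp_sum.

End PairGrading.

Section GradedModules.
Variables (k : fieldType) (B : cgalg k).
Implicit Types M N P : gmod B.
Local Notation cmp M := (comp (gm_gr M)).

Lemma comp_scale M i (n : int) (b : B) (x : M) : homog (cg_gr B) i b ->
  cmp M (i%:Z + n) (b *: x) = b *: cmp M n x.
Proof.
move=> hb; have [s us sP] := comp_finite (gm_gr M) x.
rewrite [in LHS](comp_sumE us sP) scaler_sumr raddf_sum /=.
have E (j : int) : cmp M (i%:Z + n) (b *: cmp M j x) =
    if n == j then b *: cmp M n x else 0.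
  have hj := gm_homZ hb (homog_comp (gm_gr M) j x).
  case: eqP => [<- //|/eqP nj]; first exact: gm_homZ hb (homog_comp _ _ _).
  by rewrite (comp_homog hj) // (inj_eq (addrI _)).
under eq_bigr => j _ do rewrite E.
case: (boolP (n \in s)) => ns.
  rewrite (bigD1_seq n) //= eqxx big1 ?addr0 // => j nj.
  by rewrite eq_sym (negbTE nj).
rewrite sP // scaler0 big_seq big1 // => j js.
by case: eqP => // nj; rewrite nj js in ns.
Qed.

Lemma comp_scale_sum M (s : seq nat) n (b : B) (x : M) :
  b = \sum_(i <- s) comp (cg_gr B) i b ->
  cmp M n (b *: x) = \sum_(i <- s) comp (cg_gr B) i b *: cmp M (n - i%:Z) x.
Proof.
move=> bE; rewrite {1}bE scaler_suml raddf_sum /=; apply: eq_bigr => i _.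
by rewrite -(comp_scale _ _ (homog_comp (cg_gr B) i b)) addrC subrK.
Qed.

(** Equational form of [deg0_map], suited to rewriting; for additive maps the two agree. *)
Definition gmap M N (f : M -> N) : Prop :=
  forall n x, f (cmp M n x) = cmp N n (f x).

Lemma gmap_deg0 M N (f : M -> N) : gmap f -> deg0_map f.
Proof. by move=> gf n x hx; rewrite /homog -gf hx. Qed.

Lemma deg0_gmap M N (f : {additive M -> N}) : deg0_map f -> gmap f.
Proof.
move=> df n x; have [s us xE] := comp_sum (gm_gr M) x.
rewrite [in RHS]xE [in RHS]raddf_sum /=.
have E i : f (cmp M i x) = cmp N i (f (cmp M i x)).
  by rewrite (df _ _ (homog_comp _ _ _)).
under [in RHS]eq_bigr => i _ do rewrite E.
rewrite (comp_sum_seq _ (fun i => f (cmp M i x))) //.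
case: ifPn => ns; first exact: E.
rewrite xE (comp_sum_seq _ (fun=> x)) // (negbTE ns); exact: raddf0.
Qed.

Lemma gmap_comp M N P (f : N -> P) (g : M -> N) :
  gmap f -> gmap g -> gmap (f \o g).
Proof. by move=> gf gg n x /=; rewrite gg gf. Qed.

Lemma gmap_factor M N P (i : {linear N -> P}) (g : {linear M -> N})
    (f : M -> P) : injective i -> gmap i -> gmap f ->
  (forall x, i (g x) = f x) -> gmap g.
Proof. by move=> ii gi gf E n x; apply: ii; rewrite gi !E gf. Qed.

Section Submodule.
Variables (M : gmod B) (S : {pred M}) (hS : GRing.submod_closed S).
Hypothesis hcomp : forall n x, x \in S -> cmp M n x \in S.

Lemma sub_comp_subproof n (x : submod hS) :
  cmp M n (val x) \in submod_pred hS.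
Proof. exact/hcomp/(valP x). Qed.

Definition sub_comp n (x : submod hS) : submod hS :=
  Sub (cmp M n (val x)) (sub_comp_subproof n x).

Lemma sub_comp_additive n : zmod_morphism (sub_comp n).
Proof. by move=> x y; apply: val_inj; rewrite /= !raddfB. Qed.
HB.instance Definition _ n :=
  GRing.isZmodMorphism.Build (submod hS) (submod hS) (sub_comp n)
    (sub_comp_additive n).

Lemma sub_comp_comp i j x :
  sub_comp i (sub_comp j x) = if i == j then sub_comp j x else 0.
Proof. by apply: val_inj; rewrite /= comp_comp; case: eqP. Qed.

Lemma sub_comp_sum x :
  exists2 s : seq int, uniq s & x = \sum_(i <- s) sub_comp i x.
Proof.
have [s us xE] := comp_sum (gm_gr M) (val x); exists s => //.
by apply: val_inj; rewrite raddf_sum.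
Qed.

Definition sub_gr : grading int (submod hS) :=
  @Grading int _ (fun n => sub_comp n) sub_comp_comp sub_comp_sum.

Lemma sub_homZ (i : nat) (n : int) (b : B) (x : submod hS) :
  homog (cg_gr B) i b -> homog sub_gr n x -> homog sub_gr (i%:Z + n) (b *: x).
Proof.
move=> hb hx; apply: val_inj => /=; apply: gm_homZ => //.
exact: (congr1 val hx).
Qed.

Definition gsub : gmod B := GMod sub_homZ.

End Submodule.

Section GKernel.
Variables (M N : gmod B) (f : {linear M -> N}) (gf : gmap f).

Lemma gker_subproof n x : x \in [pred x | f x == 0] ->
  cmp M n x \in [pred x | f x == 0].
Proof. by rewrite !inE gf => /eqP->; rewrite raddf0. Qed.

Definition gker : gmod B := @gsub M _ (ker_submod_closed f) gker_subproof.
Definition gkerval : {linear gker -> M} := kerval f.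

Lemma gkerval_gmap : gmap gkerval.
Proof. by move=> n x; rewrite /gkerval !kervalE. Qed.

Lemma gkerval_inj : injective gkerval. Proof. exact: kerval_inj. Qed.

Lemma exact_gkerval : exact gkerval f. Proof. exact: exact_kerval. Qed.

End GKernel.

Section GPair.
Variables M N : gmod B.

Lemma pair_homZ (i : nat) (n : int) (b : B) (x : M * N) :
  homog (cg_gr B) i b -> homog (pair_gr (gm_gr M) (gm_gr N)) n x ->
  homog (pair_gr (gm_gr M) (gm_gr N)) (i%:Z + n) (b *: x).
Proof.
move=> hb hx; have [h1 h2] : homog (gm_gr M) n x.1 /\ homog (gm_gr N) n x.2.
  by split; [apply: (congr1 fst hx)|apply: (congr1 snd hx)].
by apply: injective_projections; apply: gm_homZ.
Qed.

Definition gpair : gmod B := @GMod k B (M * N)%type _ pair_homZ.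

End GPair.

Section GShift.
Variables (M : gmod B) (a : int).

Lemma shift_homZ (i : nat) (n : int) (b : B) (x : M) :
  homog (cg_gr B) i b -> homog (shift_gr (gm_gr M) a) n x ->
  homog (shift_gr (gm_gr M) a) (i%:Z + n) (b *: x).
Proof. by move=> hb hx; rewrite /homog /= -addrA; apply: gm_homZ. Qed.

Definition gshift : gmod B := @GMod k B M _ shift_homZ.

End GShift.

Section GFree.
Variables (m : nat) (deg : 'I_m -> int).
Local Notation g := (row_gr (int_gr (cg_gr B)) deg).

Lemma int_homogM i n (b x : B) : homog (cg_gr B) i b ->
  homog (int_gr (cg_gr B)) n x -> homog (int_gr (cg_gr B)) (i%:Z + n) (b * x).
Proof.
move=> hb; case: n => [n|n] hx; first by apply: cg_homM.
by rewrite -hx /= mulr0; apply: raddf0.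
Qed.

Lemma row_homZ (i : nat) (n : int) (b : B) (x : 'rV[B]_m) :
  homog (cg_gr B) i b -> homog g n x -> homog g (i%:Z + n) (b *: x).
Proof.
move=> hb /row_homogP hx; apply/row_homogP => j.
by rewrite mxE -addrA; apply: int_homogM.
Qed.

Definition gfree : gmod B := @GMod k B 'rV[B]_m _ row_homZ.

Lemma gfree_homogP n (v : gfree) : homog (gm_gr gfree) n v <->
  forall j, homog (int_gr (cg_gr B)) (n - deg j) (v 0 j).
Proof. exact: row_homogP. Qed.

Lemma gfree_delta j : homog (gm_gr gfree) (deg j) (delta_mx 0 j : gfree).
Proof.
apply/gfree_homogP => l; rewrite mxE eqxx /=; case: eqP => [->|_].
  by rewrite subrr /=; have := scalar_homog B 1; rewrite scale1r.
exact: homog0.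
Qed.

Lemma row_map_gmap M (x : 'I_m -> M) :
  (forall j, homog (gm_gr M) (deg j) (x j)) ->
  gmap (row_map x : gfree -> M).
Proof.
move=> hx; apply: deg0_gmap => n v /gfree_homogP hv.
rewrite [X in homog _ _ X]row_mapE; apply: homog_sum => j _.
have := hv j; case nj: (n - deg j) => [l|l] h.
  by rewrite -[n](subrK (deg j)) nj; apply: gm_homZ.
by rewrite -h scale0r; apply: homog0.
Qed.

End GFree.

Definition gproj P : Prop := forall (M N : gmod B) (g : {linear M -> N})
  (f : {linear P -> N}), gmap g -> gmap f -> surj g ->
  exists2 h : {linear P -> M}, gmap h & forall x, g (h x) = f x.

Lemma gfree_gproj m (deg : 'I_m -> int) : gproj (gfree deg).
Proof.
move=> M N g f gg gf gs.
(* The degree [deg j] component of any preimage is again a preimage, because the basis vector is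
   homogeneous of that degree. *)
have ex j : exists x : M, homog (gm_gr M) (deg j) x /\ g x = f (delta_mx 0 j).
  have [x xE] := gs (f (delta_mx 0 j)); exists (cmp M (deg j) x).
  split; first exact: homog_comp.
  by rewrite gg xE -gf; congr (f _); apply: gfree_delta.
pose x_ j := sval (cid (ex j)).
exists (row_map x_ : {linear gfree deg -> M}).
  by apply: row_map_gmap => j; rewrite /x_; case: cid => x [].
move=> v; rewrite [RHS](row_map_eq f) row_mapE linear_sum.
apply: eq_bigr => j _.
by rewrite linearZ /x_; case: cid => x [_ /= ->].
Qed.

(* The degree 0 part x |-> \sum_n (h (x_n))_n of an ungraded lift h is a lift. *)
Lemma projective_gproj P : projective P -> gproj P.
Proof.
move=> pP M N g f gg gf gs; have [h hE] := pP M N g f gs.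
have ex x : exists y, forall n, cmp M n y = cmp M n (h (cmp P n x)).
  have [s us sP] := comp_finite (gm_gr P) x.
  exists (\sum_(n <- s) cmp M n (h (cmp P n x))) => n.
  rewrite (comp_sum_seq _ (fun n => h (cmp P n x))) //.
  by case: ifPn => // /sP->; rewrite linear0 raddf0.
pose h0 x := sval (cid (ex x)).
have h0E x n : cmp M n (h0 x) = cmp M n (h (cmp P n x)).
  by rewrite /h0; case: cid.
have hl : linear h0.
  move=> b x y; apply: (comp_ext (g := gm_gr M)) => n.
  have [s _ bE] := comp_sum (cg_gr B) b.
  rewrite h0E !raddfD /= h0E (comp_scale_sum _ _ bE).
  congr (_ + _); rewrite (comp_scale_sum _ _ bE) linear_sum raddf_sum /=.
  apply: eq_bigr => i _; rewrite linearZ h0E /=.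
  by rewrite -(comp_scale _ _ (homog_comp (cg_gr B) i b)) [i%:Z + _]addrC subrK.
exists (mklin hl) => [n x|x] /=.
  apply: (comp_ext (g := gm_gr M)) => l; rewrite h0E !comp_comp.
  by case: eqP => [->|_]; rewrite ?linear0 ?raddf0 ?h0E.
apply: (comp_ext (g := gm_gr N)) => n.
by rewrite -gg h0E gg hE gf comp_comp eqxx.
Qed.

End GradedModules.

(** * Regularity *)

Section Regularity.
Variables (k : fieldType) (B : cgalg k).
Implicit Types F K M N P X Om : gmod B.
Local Notation cmp M := (comp (gm_gr M)).

Definition gses K M N (i : {linear K -> M}) (q : {linear M -> N}) : Prop :=
  [/\ gmap i, gmap q, injective i, surj q & exact i q].

Definition gen_le (c : int) M : Prop :=
  exists m (deg : 'I_m -> int) (f : {linear gfree B deg -> M}),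
    [/\ gmap f, surj f & forall j, deg j <= c].

Lemma gen_le_mono c c' M : c <= c' -> gen_le c M -> gen_le c' M.
Proof.
move=> cc [m [deg [f [gf fs dc]]]]; exists m, deg, f; split=> // j.
exact: le_trans (dc j) cc.
Qed.

Lemma gen_le_surj c M N (f : {linear M -> N}) :
  gmap f -> surj f -> gen_le c M -> gen_le c N.
Proof.
move=> gf fs [m [deg [g [gg gs dc]]]]; exists m, deg, (f \o g)%FUN; split=> //.
  exact: gmap_comp.
by move=> y; have [x <-] := fs y; have [z <-] := gs x; exists z.
Qed.

Lemma gen_le_free c m (deg : 'I_m -> int) :
  (forall j, deg j <= c) -> gen_le c (gfree B deg).
Proof. by move=> dc; exists m, deg, idfun; split=> // y; exists y. Qed.

Lemma gen_le_pair c M N : gen_le c M -> gen_le c N -> gen_le c (gpair M N).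
Proof.
move=> [m [deg [f [gf fs dc]]]] [m' [deg' [f' [gf' fs' dc']]]].
pose dd (j : 'I_(m + m')) :=
  match split j with inl a => deg a | inr b => deg' b end.
have hl : linear (fun v : gfree B dd => (f (lsubmx v), f' (rsubmx v))).
  by move=> a u v; apply: injective_projections => /=; rewrite !linearP.
exists (m + m')%N, dd, (mklin hl : {linear gfree B dd -> gpair M N}); split.
- move=> n v; apply: injective_projections => /=; rewrite -?gf -?gf'.
    congr (f _); apply/rowP => j; rewrite !mxE /dd.
    by rewrite -[lshift _ _]/(unsplit (inl j)) unsplitK.
  congr (f' _); apply/rowP => j; rewrite !mxE /dd.
  by rewrite -[rshift _ _]/(unsplit (inr j)) unsplitK.
- move=> [x y]; have [u uE] := fs x; have [v vE] := fs' y.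
  by exists (row_mx u v); rewrite /= row_mxKl row_mxKr uE vE.
by move=> j; rewrite /dd; case: split.
Qed.

Lemma gproj_pair M N : gproj M -> gproj N -> gproj (gpair M N).
Proof.
move=> pM pN X Y g f gg gf gs.
have l1 : linear (fun x : M => (x, 0 : N)).
  by move=> a u v; apply: injective_projections; rewrite /= ?scaler0 ?addr0.
have l2 : linear (fun x : N => (0 : M, x)).
  by move=> a u v; apply: injective_projections; rewrite /= ?scaler0 ?addr0.
pose i1 : {linear M -> gpair M N} := mklin l1.
pose i2 : {linear N -> gpair M N} := mklin l2.
have g1 : gmap i1.
  by move=> n x; apply: injective_projections; rewrite /= ?raddf0.
have g2 : gmap i2.
  by move=> n x; apply: injective_projections; rewrite /= ?raddf0.
have [h1 gh1 h1E] := pM X Y g (f \o i1)%FUN gg (gmap_comp gf g1) gs.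
have [h2 gh2 h2E] := pN X Y g (f \o i2)%FUN gg (gmap_comp gf g2) gs.
have hl : linear (fun x : gpair M N => h1 x.1 + h2 x.2).
  by move=> a u v; rewrite !linearP /= scalerDr addrACA.
exists (mklin hl) => [n x|[x y]] /=; first by rewrite gh1 gh2 raddfD.
rewrite raddfD /= h1E h2E /= -raddfD.
by congr (f _); apply: injective_projections; rewrite /= ?addr0 ?add0r.
Qed.

(** * Resolutions with generator degrees of slope e: 0 over T, 1 over the Veronese ring *)

Section Slope.
Variable e : int.

(* The first n terms of a projective resolution of M can be chosen finitely
   generated, the i-th one in degrees <= c + i e. *)
Fixpoint reg_le (n : nat) (c : int) (M : gmod B) : Prop :=
  if n is n'.+1 then
    exists (P K : gmod B) (i : {linear K -> P}) (p : {linear P -> M}),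
      [/\ gproj P, gen_le c P, gses i p & reg_le n' (c + e) K]
  else True.

Lemma reg_le_gen n c M : reg_le n.+1 c M -> gen_le c M.
Proof.
by move=> [P [K [i [p [_ gP [_ gp _ ps _] _]]]]]; apply: gen_le_surj gP.
Qed.

Lemma reg_le_mono n c c' M : c <= c' -> reg_le n c M -> reg_le n c' M.
Proof.
elim: n c c' M => //= n IHn c c' M cc [P [K [i [p [pP gP ex hK]]]]].
exists P, K, i, p; split=> //; first exact: gen_le_mono gP.
by apply: IHn hK; rewrite lerD2r.
Qed.

Lemma reg_leS n c M : reg_le n.+1 c M -> reg_le n c M.
Proof.
elim: n c M => // n IHn c M [P [K [i [p [pP gP ex hK]]]]].
by exists P, K, i, p; split=> //; apply: IHn hK.
Qed.

Lemma reg_le_leq n n' c M : (n <= n')%N -> reg_le n' c M -> reg_le n c M.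
Proof.
move=> /subnK <-; elim: (n' - n)%N => // l IHl h; apply/IHl/reg_leS.
by rewrite addSn in h.
Qed.

Lemma gses_iso K M N N' (i : {linear K -> M}) (q : {linear M -> N})
    (f : {linear N -> N'}) :
  gmap f -> injective f -> surj f -> gses i q -> gses i (f \o q)%FUN.
Proof.
move=> gf fi fs [gi gq ii qs ex]; split=> //; first exact: gmap_comp.
  by move=> y; have [x <-] := fs y; have [z <-] := qs x; exists z.
move=> y; rewrite -ex /=; split=> [|->]; last exact: linear0.
by rewrite -(linear0 f) => /fi.
Qed.

Lemma reg_le_iso n c M N (f : {linear M -> N}) :
  gmap f -> injective f -> surj f -> reg_le n c M -> reg_le n c N.
Proof.
case: n => //= n gf fi fs [P [K [i [p [pP gP ex hK]]]]].
by exists P, K, i, (f \o p)%FUN; split=> //; apply: gses_iso.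
Qed.

Lemma reg_le_zero n c M : (forall x : M, x = 0) -> reg_le n c M.
Proof.
move=> M0; elim: n c => //= n IHn c; exists M, M, idfun, idfun; split=> //.
- move=> X Y g f gg gf gs.
  have hl : linear (fun _ : M => 0 : X) by move=> a u v; rewrite scaler0 addr0.
  exists (mklin hl) => [l x|x] /=; first by rewrite raddf0.
  by rewrite (M0 x) !linear0.
- pose deg (j : 'I_0) : int := 0.
  exists 0%N, deg, (row_map (fun j : 'I_0 => 0 : M)); split; last by case.
    by move=> l v; rewrite (M0 (cmp M l _)) (M0 (row_map _ _)).
  by move=> y; exists 0; rewrite (M0 y) linear0.
split=> // [y|y]; first by exists y.
by split=> [_|_]; [exists y|apply: M0].
Qed.

Lemma reg_le_proj n c P : gproj P -> gen_le c P -> reg_le n c P.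
Proof.
case: n => //= n pP gP.
have gid : gmap (idfun : {linear P -> P}) by [].
exists P, (gker gid), (gkerval gid), idfun; split=> //.
  split=> //; [exact: gkerval_gmap|exact: gkerval_inj|by move=> y; exists y|].
  exact: exact_gkerval.
apply: reg_le_zero => x; apply: (@gkerval_inj _ _ _ _ _ gid).
by rewrite linear0; apply: (exact_comp0 (exact_gkerval gid) x).
Qed.

Lemma gses_factor K M N X (i : {linear K -> M}) (q : {linear M -> N})
    (f : {linear X -> M}) :
  gses i q -> gmap f -> (forall x, q (f x) = 0) ->
  exists2 g : {linear X -> K}, gmap g & forall x, i (g x) = f x.
Proof.
move=> [gi _ ii _ ex] gf f0.
have [|g gE] := @linear_factor _ _ _ _ i f ii; first by move=> x; apply/ex.
by exists g => //; apply: gmap_factor gE.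
Qed.

Lemma gker_gses M N (f : {linear M -> N}) (gf : gmap f) :
  surj f -> gses (gkerval gf) f.
Proof.
by split=> //; [exact: gkerval_gmap|exact: gkerval_inj|exact: exact_gkerval].
Qed.

(** Horseshoe lemma: the cover of N lifts to M and, together with that of K, covers M; the kernels
    form a short exact sequence again, so the induction continues. *)
Lemma reg_le_ext n c K M N (i : {linear K -> M}) (q : {linear M -> N}) :
  gses i q -> reg_le n c K -> reg_le n c N -> reg_le n c M.
Proof.
elim: n c K M N i q => //= n IHn c K M N i q [gi gq ii qs ex].
move=> [P' [K' [i' [p' [pP' gP' [gi' gp' ii' ps' ex'] hK']]]]].
move=> [P2 [K2 [i2 [p2 [pP2 gP2 ses2 hK2]]]]].
have [gi2 gp2 ii2 ps2 ex2] := ses2.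
have [h gh hE] := pP2 _ _ q p2 gq gp2 qs.
have pl : linear (fun x : gpair P' P2 => i (p' x.1) + h x.2).
  by move=> a u v; rewrite !linearP /= scalerDr addrACA.
pose p : {linear gpair P' P2 -> M} := mklin pl.
have gp : gmap p by move=> l x; rewrite /= gp' gi gh raddfD.
have ps : surj p.
  move=> y; have [x2 x2E] := ps2 (q y).
  have [|z zE] := (ex (y - h x2)).1; first by rewrite linearB hE x2E subrr.
  by have [x1 x1E] := ps' z; exists (x1, x2); rewrite /= x1E zE subrK.
have sesW := gker_gses gp ps.
exists (gpair P' P2), (gker gp), (gkerval gp), p; split=> //.
- exact: gproj_pair.
- exact: gen_le_pair.
have al : linear (fun x : K' => (i' x, 0 : P2)).
  by move=> b u v; apply: injective_projections;
    rewrite /= ?linearP ?scaler0 ?addr0.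
pose a0 : {linear K' -> gpair P' P2} := mklin al.
have ga0 : gmap a0.
  by move=> l x; apply: injective_projections; rewrite /= ?gi' ?raddf0.
have [|a ga aE] := gses_factor sesW ga0.
  by move=> x; rewrite /= (exact_comp0 ex') !linear0 addr0.
pose v := gkerval gp; have vi : injective v by apply: gkerval_inj.
have bl : linear (fun z => (v z).2) by move=> b u w; rewrite linearP.
pose b0 : {linear gker gp -> P2} := mklin bl.
have gb0 : gmap b0 by move=> l x; rewrite /= [v _]gkerval_gmap.
have pv z : i (p' (v z).1) + h (v z).2 = 0.
  exact: (exact_comp0 (exact_gkerval gp) z).
have [|b gb bE] := gses_factor ses2 gb0.
  by move=> z; have /(congr1 q) := pv z;
    rewrite linearD linear0 /= (exact_comp0 ex) add0r hE.
apply: (IHn _ _ _ _ a b _ hK' hK2); split=> //.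
- by move=> x y /(congr1 v); rewrite !aE => -[] /ii'.
(* The element [h (i2 y)] lies in K, so a preimage x of it under [p'] corrects (0, i2 y) to an
   element of the kernel of [p]. *)
- move=> y; have /ex[m mE] : q (h (i2 y)) = 0.
    by rewrite hE (exact_comp0 ex2).
  have [x xE] := ps' m; have [|z zE] := (exact_gkerval gp (- x, i2 y)).1.
    by rewrite /= !linearN /= xE mE addNr.
  by exists z; apply: ii2; rewrite bE /= [v z]zE.
move=> z; split=> [z0|[x <-]]; last first.
  by apply: ii2; rewrite bE /= [v _]aE linear0.
have v2 : (v z).2 = 0 by have := bE z; rewrite z0 linear0 => /esym.
have := pv z; rewrite v2 linear0 addr0 -(linear0 i) => /ii /ex'[x xE].
exists x; apply: vi; rewrite [LHS]aE; apply: injective_projections => /=.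
  exact: xE.
by rewrite v2.
Qed.

(** The composite P -> M -> N has as kernel an extension of K by the first syzygy of M. Thus K
    enters one stage later, which explains its bound c + e. *)
Lemma reg_le_coker n c K M N (i : {linear K -> M}) (q : {linear M -> N}) :
  gses i q -> reg_le n (c + e) K -> reg_le n.+1 c M -> reg_le n.+1 c N.
Proof.
move=> ses hK [P [K' [i' [p [pP gP ses' hK']]]]].
have [gi gq ii qs ex] := ses; have [gi' gp ii' ps ex'] := ses'.
have gqp : gmap (q \o p)%FUN by apply: gmap_comp.
have qps : surj (q \o p)%FUN.
  by move=> y; have [x <-] := qs y; have [z <-] := ps x; exists z.
have sesW := gker_gses gqp qps.
exists P, (gker gqp), (gkerval gqp), (q \o p)%FUN; split=> //.
have [|a ga aE] := gses_factor sesW gi'.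
  by move=> x; rewrite /= (exact_comp0 ex') linear0.
pose v := gkerval gqp; have vi : injective v by apply: gkerval_inj.
have gpv : gmap (p \o v)%FUN by apply: gmap_comp => //; apply: gkerval_gmap.
have [|b gb bE] := gses_factor ses gpv.
  exact: (exact_comp0 (exact_gkerval gqp)).
apply: (reg_le_ext (i := a) (q := b)) => //; split=> //.
- by move=> x y /(congr1 v); rewrite !aE => /ii'.
- move=> y; have [x xE] := ps (i y); have [|z zE] := (exact_gkerval gqp x).1.
    by rewrite /= xE (exact_comp0 ex).
  by exists z; apply: ii; rewrite bE /= [v z]zE.
move=> z; split=> [z0|[x <-]]; last first.
  by apply: ii; rewrite bE /= [v _]aE (exact_comp0 ex') linear0.
have := bE z; rewrite z0 linear0 => /esym/ex'[x xE].
by exists x; apply: vi; rewrite [LHS]aE.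
Qed.

(* The pullback of F and a projective cover P of M is an extension of F by the
   kernel of P -> M, and is isomorphic to Om (+) P. *)
Lemma reg_le_ker n c c' Om F M (i : {linear Om -> F}) (q : {linear F -> M}) :
  gses i q -> c <= c' + e -> c + e <= c' ->
  reg_le n.+1 c M -> reg_le n c' F -> reg_le n c' Om.
Proof.
case: n => [//|n] ses cc' cc [P [K [j [p [pP gP [gj gp jj ps exj] hK]]]]] hF.
have [gi gq ii qs ex] := ses.
have wl : linear (fun x : gpair P F => p x.1 - q x.2).
  by move=> a u v; rewrite (linearP p) (linearP q) scalerBr opprD addrACA.
pose w : {linear gpair P F -> M} := mklin wl.
have gw : gmap w by move=> l x; rewrite /= gp gq raddfB.
have ws : surj w.
  by move=> y; have [x xE] := ps y; exists (x, 0); rewrite /= xE linear0 subr0.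
have sesW := gker_gses gw ws.
pose v := gkerval gw; have vi : injective v by apply: gkerval_inj.
have gv : gmap v by apply: gkerval_gmap.
have vE z : p (v z).1 = q (v z).2.
  by apply/eqP; rewrite -subr_eq0; apply/eqP/(exact_gkerval gw); exists z.
have Wof x y : p x = q y -> exists z, v z = (x, y).
  by move=> xy; apply/(exact_gkerval gw); rewrite /= xy subrr.
have hW : reg_le n.+1 c' (gker gw).
  have al : linear (fun x : K => (j x, 0 : F)).
    by move=> b x y; apply: injective_projections;
      rewrite /= ?linearP ?scaler0 ?addr0.
  pose a0 : {linear K -> gpair P F} := mklin al.
  have ga0 : gmap a0.
    by move=> l x; apply: injective_projections; rewrite /= ?gj ?raddf0.
  have [|a ga aE] := gses_factor sesW ga0.
    by move=> x; rewrite /= (exact_comp0 exj) linear0 subr0.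
  have bl : linear (fun z => (v z).2) by move=> b x y; rewrite linearP.
  pose b : {linear gker gw -> F} := mklin bl.
  have hK1 : reg_le n.+1 c' K := @reg_le_mono n.+1 _ _ K cc hK.
  apply: (reg_le_ext (i := a) (q := b) _ hK1 hF); split=> //.
  - by move=> l x; rewrite /= gv.
  - by move=> x y /(congr1 v); rewrite !aE => -[] /jj.
  - move=> y; have [x xE] := ps (q y); have [z zE] := Wof x y xE.
    by exists z; rewrite /= zE.
  move=> z; split=> [/= z0|[x <-]]; last by rewrite /= [v _]aE.
  have /exj[x xE] : p (v z).1 = 0 by rewrite vE z0 linear0.
  exists x; apply: vi; rewrite [LHS]aE; apply: injective_projections => //=.
(* Projectivity lifts [p] to F. The graph of [h] embeds P in the pullback, and y - h x identifies
   the quotient with Om. *)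
have [h gh hE] := pP _ _ q p gq gp qs.
have al : linear (fun x : P => (x, h x)).
  by move=> b x y; apply: injective_projections; rewrite /= ?linearP.
pose a0 : {linear P -> gpair P F} := mklin al.
have ga0 : gmap a0 by move=> l x; apply: injective_projections; rewrite /= ?gh.
have [|a ga aE] := gses_factor sesW ga0; first by move=> x; rewrite /= hE subrr.
have bl : linear (fun z => (v z).2 - h (v z).1).
  move=> b x y; rewrite (linearP v) /= (linearP h) scalerBr opprD.
  by rewrite addrACA.
pose b0 : {linear gker gw -> F} := mklin bl.
have gb0 : gmap b0 by move=> l x; rewrite /= gv /= gh raddfB.
have [|b gb bE] := gses_factor ses gb0.
  by move=> z; rewrite /= linearB /= hE vE subrr.
apply: (reg_le_coker (i := a) (q := b) _ _ hW); last first.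
  by apply: reg_le_proj => //; apply: gen_le_mono gP.
split=> //.
- by move=> x y /(congr1 v); rewrite !aE => -[].
- move=> y; have [|z zE] := Wof 0 (i y).
    by rewrite (exact_comp0 ex) linear0.
  by exists z; apply: ii; rewrite bE /= zE linear0 subr0.
move=> z; split=> [z0|[x <-]]; last first.
  by apply: ii; rewrite bE /= [v _]aE subrr linear0.
have := bE z; rewrite z0 linear0 /= => /esym/eqP; rewrite subr_eq0 => /eqP z2.
exists (v z).1; apply: vi; rewrite [LHS]aE; apply: injective_projections => //=.
Qed.

Lemma gproj_shift a P : gproj P -> gproj (gshift P a).
Proof.
move=> pP M N g f gg gf gs.
have [||h gh hE] :=
  pP (gshift M (- a)) (gshift N (- a)) (g : {linear M -> N})
     (f : {linear gshift P a -> N}) _ _ gs.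
- by move=> n x; apply: gg.
- by move=> n x; have := gf (n - - a) x; rewrite /= opprK addrK.
exists (h : {linear P -> gshift M (- a)}) => // n x.
by have := gh (n - a) x; rewrite /= opprK subrK.
Qed.

Lemma gen_le_shift c a M : gen_le c M -> gen_le (c + a) (gshift M a).
Proof.
move=> [m [deg [f [gf fs dc]]]].
exists m, (fun j => deg j + a), (f : {linear gfree B deg -> M}); split=> //.
  move=> n v; rewrite /= -gf; congr (f _); apply/rowP => j; rewrite !mxE.
  by rewrite [deg j + a]addrC opprD addrA.
by move=> j; rewrite lerD2r.
Qed.

Lemma reg_le_shift n c a M : reg_le n c M -> reg_le n (c + a) (gshift M a).
Proof.
elim: n c M => //= n IHn c M [P [K [i [p [pP gP [gi gp ii ps ex] hK]]]]].
exists (gshift P a), (gshift K a), (i : {linear K -> P}), (p : {linear P -> M}).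
split.
- exact: gproj_shift.
- exact: gen_le_shift.
- by split=> // l x; [apply: gi|apply: gp].
by rewrite addrAC; apply: IHn.
Qed.

End Slope.

Lemma fin_gen_gen_le M : fin_gen M -> exists c, gen_le c M.
Proof.
move=> /fin_gen_span fM.
have [x|m [y [hy ys]]] := fM (fun x => exists n, homog (gm_gr M) n x).
  have [s _ xE] := comp_sum (gm_gr M) x.
  exists [seq (1, cmp M i x) | i <- s]; split=> [p /mapP[i _ ->]|].
    by exists i; apply: homog_comp.
  by rewrite big_map {1}xE; apply: eq_bigr => i _; rewrite scale1r.
pose deg j := sval (cid (hy j)).
have hdeg j : homog (gm_gr M) (deg j) (y j) by apply: (svalP (cid (hy j))).
(* A crude upper bound for all the degrees, which makes sense for m = 0 as well. *)
exists (\sum_j `|deg j|), m, deg, (row_map y); split=> //.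
  exact: row_map_gmap.
move=> l; rewrite (bigD1 l) //= (le_trans (ler_norm _)) // lerDl.
by apply: sumr_ge0.
Qed.

Lemma gen_le_fin_gen c M : gen_le c M -> fin_gen M.
Proof. by move=> [m [deg [f [_ fs _]]]]; exists m, f. Qed.

(** Induction on the projective dimension: by Schanuel the syzygy of a finite free cover has smaller
    dimension, and it is finitely generated by noetherianity. A projective module resolves itself,
    so one bound serves all n. *)
Lemma bounded_reg M : left_noetherian B -> finite_gldim B -> fin_gen M ->
  exists r, forall n, reg_le 0 n r M.
Proof.
move=> nB [m hm]; have := pdim_leW (hm M); elim: m {hm} M => [|m IHm] M hM fM.
  have [c gM] := fin_gen_gen_le fM; exists c => n.
  by apply: reg_le_proj => //; apply: projective_gproj.
have [c [l [deg [f [gf fs dc]]]]] := fin_gen_gen_le fM.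
have ses := gker_gses gf fs.
have [||r hr] := IHm (gker gf).
- apply: (proj_dim_le_ker (@rV_projective _ l) _ _ fs hM).
    exact: (@gkerval_inj _ _ _ _ _ gf).
  exact: exact_gkerval.
- by apply: (noetherian_rV (i := gkerval gf)) => //; apply: gkerval_inj.
exists (Num.max r c) => -[//|n] /=.
exists (gfree B deg), (gker gf), (gkerval gf), f; split=> //.
- exact: gfree_gproj.
- by apply: gen_le_free => j; rewrite le_max dc orbT.
by rewrite addr0; apply: reg_le_mono (hr n); rewrite le_max lexx.
Qed.

End Regularity.

(** * Restriction of scalars and the augmentation ideal *)

Section FreeSequence.
Variables (k : fieldType) (B : cgalg k).

Definition gfree1 (a : int) : gmod B := gfree B (fun _ : 'I_1 => a).

(** Splits off the first basis vector, so that claims on finite free modules reduce to rank one by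
    induction. *)
Lemma gfree_ses m (deg : 'I_m.+1 -> int) :
  exists (i : {linear gfree B (deg \o lift ord0) -> gfree B deg})
         (q : {linear gfree B deg -> gfree1 (deg ord0)}), gses i q.
Proof.
pose i0 (v : 'rV[B]_m) : 'rV[B]_m.+1 :=
  \row_j (if unlift ord0 j is Some l then v 0 l else 0).
have il : linear i0.
  move=> a u v; apply/rowP => j; rewrite !mxE.
  by case: unlift => [l|]; rewrite ?mxE // mulr0 addr0.
pose q0 (v : 'rV[B]_m.+1) : 'rV[B]_1 := \row_j v 0 ord0.
have ql : linear q0 by move=> a u v; apply/rowP => j; rewrite !mxE.
exists (mklin il : {linear gfree B (deg \o lift ord0) -> gfree B deg}).
exists (mklin ql : {linear gfree B deg -> gfree1 (deg ord0)}).
split.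
- move=> n v; apply/rowP => j; rewrite !mxE.
  by case: unliftP => [l ->|->]; rewrite ?mxE ?raddf0.
- by move=> n v; apply/rowP => j; rewrite !mxE.
- by move=> u v /rowP uv; apply/rowP => j; have := uv (lift ord0 j);
    rewrite !mxE liftK.
- move=> v; exists (\row_j v 0 0); apply/rowP => j; rewrite !mxE.
  by rewrite (ord1 j).
move=> v; split=> [/rowP v0|[u <-]]; last first.
  by apply/rowP => j; rewrite !mxE unlift_none.
exists (\row_j v 0 (lift ord0 j)); apply/rowP => j; rewrite !mxE.
case: unliftP => [l ->|->]; first by rewrite mxE.
by have := v0 0; rewrite !mxE.
Qed.

End FreeSequence.

Section Restriction.
Variables (k : fieldType) (T A : cgalg k) (phi : {lrmorphism T -> A}).
Hypothesis phi_gr : graded_map phi.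
Implicit Types F K M N X Z : gmod A.

(* f is a phantom: it selects the T-module structure. *)
Definition res_type (f : T -> A) (M : gmod A) : Type := M.

Section Module.
Variable M : gmod A.
Local Notation V := (res_type phi M).
HB.instance Definition _ := GRing.Zmodule.on V.

Definition res_scale (t : T) (x : V) : V := phi t *: (x : M).

Lemma res_scaleA a b v : res_scale a (res_scale b v) = res_scale (a * b) v.
Proof. by rewrite /res_scale scalerA rmorphM. Qed.
Lemma res_scale1 : left_id 1 res_scale.
Proof. by move=> v; rewrite /res_scale rmorph1 scale1r. Qed.
Lemma res_scaleDr : right_distributive res_scale +%R.
Proof. by move=> a u v; apply: scalerDr. Qed.
Lemma res_scaleDl v : {morph res_scale^~ v : a b / a + b}.
Proof. by move=> a b; rewrite /res_scale raddfD scalerDl. Qed.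

HB.instance Definition _ := GRing.Zmodule_isLmodule.Build T V
  res_scaleA res_scale1 res_scaleDr res_scaleDl.

Lemma res_homZ (i : nat) (n : int) (t : T) (x : V) :
  homog (cg_gr T) i t -> homog (gm_gr M : grading int V) n x ->
  homog (gm_gr M : grading int V) (i%:Z + n) (t *: x).
Proof. by move=> ht hx; apply: gm_homZ => //; apply: phi_gr. Qed.

Definition gres : gmod T := GMod res_homZ.
End Module.

Lemma res_map_linear M N (f : {linear M -> N}) :
  linear (f : gres M -> gres N).
Proof. by move=> a u v; apply: linearP. Qed.

Definition res_map M N (f : {linear M -> N}) : {linear gres M -> gres N} :=
  mklin (res_map_linear f).

Lemma gres_ses K M N (i : {linear K -> M}) (q : {linear M -> N}) :
  gses i q -> gses (res_map i) (res_map q).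
Proof. by []. Qed.

(** Generators over T also generate over A, in unchanged degrees; this is how bounds over T produce
    free covers over A. *)
Lemma gen_le_res c M : gen_le c (gres M) -> gen_le c M.
Proof.
move=> [m [deg [f [gf fs dc]]]]; pose x j : M := f (delta_mx 0 j).
exists m, deg, (row_map x); split=> //.
  by apply: row_map_gmap => j; apply: (gmap_deg0 gf); apply: gfree_delta.
move=> y; have [v <-] := fs y; exists (\row_j phi (v 0 j)).
by rewrite row_mapE (row_map_eq f); apply: eq_bigr => j _; rewrite mxE.
Qed.

Section Bound.
Variable rA : int.
Hypothesis hA : forall n, reg_le 0 n rA (gres (gfree1 A 0)).

Lemma res_gfree1_reg n a : reg_le 0 n (rA + a) (gres (gfree1 A a)).
Proof.
have fl : linear (idfun : gshift (gres (gfree1 A 0)) a -> gres (gfree1 A a)).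
  by [].
apply: (reg_le_iso (f := mklin fl) _ _ _ (reg_le_shift a (hA n))).
- by move=> l v; apply/rowP => j; rewrite !mxE subr0.
- by [].
by move=> y; exists y.
Qed.

Lemma res_gfree_reg n r m (deg : 'I_m -> int) :
  (forall j, deg j <= r) -> reg_le 0 n (rA + r) (gres (gfree A deg)).
Proof.
elim: m deg => [|m IHm] deg hd.
  by apply: reg_le_zero => v; apply/rowP => -[].
have [i [q ses]] := gfree_ses A deg.
apply: (reg_le_ext (gres_ses ses)); first by apply: IHm => j; apply: hd.
by apply: reg_le_mono (res_gfree1_reg n (deg ord0)); rewrite lerD2l.
Qed.

(** A free A-module on generators of degree at most r' has T-regularity at most rA + r'. With slope
    0, the kernel is then bounded by any s above both r and rA + r'. *)
Lemma res_ker_reg r r' s K Z m (deg : 'I_m -> int)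
    (i : {linear K -> gfree A deg}) (q : {linear gfree A deg -> Z}) :
  gses i q -> (forall j, deg j <= r') -> r <= s -> rA + r' <= s ->
  (forall n, reg_le 0 n r (gres Z)) -> forall n, reg_le 0 n s (gres K).
Proof.
move=> ses hd rs r's hZ n.
apply: (reg_le_ker (gres_ses ses) _ _ (hZ n.+1)); rewrite ?addr0 //.
exact/(reg_le_mono r's)/res_gfree_reg.
Qed.

End Bound.

Lemma res_gfree1_fin_gen a : finite_map phi -> fin_gen (gres (gfree1 A a)).
Proof.
move=> [[s sP] _].
pose x (j : 'I_(size s)) : gres (gfree1 A a) := const_mx s`_j : 'rV[A]_1.
exists (size s), (row_map x) => v; have [c cE] := sP (v 0 0).
exists (\row_j c j); rewrite row_mapE; apply/rowP => l.
rewrite (ord1 l) cE summxE; apply: eq_bigr => j _.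
by rewrite [X in X *: x j]mxE [LHS]mxE mxE.
Qed.

End Restriction.

Section Augmentation.
Variables (k : fieldType) (A : cgalg k).
Local Notation A1 := (gfree1 A 0).

Lemma augm_scalar (c : k) : augm (c%:A : A) = c.
Proof.
by apply: scalarA_inj (etrans (esym (augmE _)) _); apply: scalar_homog.
Qed.

Definition aug_map : {linear A1 -> triv_mod A} :=
  row_map (fun _ : 'I_1 => (1 : k) : triv_mod A).

Lemma aug_mapE v : aug_map v = augm (v 0 0) :> k.
Proof. by rewrite /aug_map row_mapE big_ord1; apply: mulr1. Qed.

Lemma aug_map_gmap : gmap aug_map.
Proof.
by apply: row_map_gmap => j; rewrite /homog /= /triv_comp eqxx.
Qed.

Lemma aug_map_surj : surj aug_map.
Proof.
by move=> c; exists (const_mx (c : k)%:A); rewrite aug_mapE mxE augm_scalar.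
Qed.

(** This is A_{>=1}, the first syzygy of k. *)
Definition augker : gmod A := gker aug_map_gmap.
Definition augval : {linear augker -> A1} := gkerval aug_map_gmap.

Lemma augker_ses : gses augval aug_map.
Proof. exact: gker_gses aug_map_surj. Qed.

Lemma augkerP (a : A) : augm a = 0 -> exists z, augval z = const_mx a.
Proof.
by move=> a0; apply/exact_gkerval; rewrite aug_mapE mxE.
Qed.

Lemma augker_homog (a : A) z i :
  homog (cg_gr A) i a -> augval z = const_mx a -> homog (gm_gr augker) i%:Z z.
Proof.
move=> ha zE; apply: (@gkerval_inj _ _ _ _ _ aug_map_gmap).
rewrite gkerval_gmap -/augval zE; apply/rowP => j.
by rewrite !mxE subr0.
Qed.

(** The elements whose positive part lies in the left ideal generated by A_1 form a subalgebra
    containing A_1, hence are all of A. *)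
Lemma deg1_span (x : A) : generated_deg1 A -> exists s : seq (A * A),
  (forall p, p \in s -> homog (cg_gr A) 1%N p.2) /\
  x - (augm x)%:A = \sum_(p <- s) p.1 * p.2.
Proof.
pose J (y : A) := exists s : seq (A * A),
  (forall p, p \in s -> homog (cg_gr A) 1%N p.2) /\ y = \sum_(p <- s) p.1 * p.2.
have JD y z : J y -> J z -> J (y + z).
  move=> [s [sP ->]] [t [tP ->]]; exists (s ++ t); split=> [p|].
    by rewrite mem_cat => /orP[]; [apply: sP|apply: tP].
  by rewrite big_cat.
have JM a y : J y -> J (a * y).
  move=> [s [sP ->]]; exists [seq (a * p.1, p.2) | p <- s]; split.
    by move=> _ /mapP[p /sP ps ->].
  by rewrite big_map mulr_sumr; apply: eq_bigr => p _; rewrite mulrA.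
move=> gA; pose S : {pred A} := [pred y | `[< J (y - (augm y)%:A) >]].
apply/asboolP/(gA S); last first.
  move=> y hy; apply/asboolP; rewrite (augm_homog_gt0 hy) // scale0r subr0.
  exists [:: (1, y)]; split=> [p|]; last by rewrite big_seq1 mul1r.
  by rewrite inE => /eqP->.
split.
- by apply/asboolP; exists [::]; rewrite augm1 scale1r subrr big_nil.
- move=> c u v /asboolP hu /asboolP hv; apply/asboolP.
  rewrite augmD -[c *: u]mulr_algl augmM augm_scalar scalerDl opprD addrACA.
  apply: JD => //; have -> : (c * augm u)%:A = c%:A * (augm u)%:A :> A.
    by rewrite mulr_algl scalerA.
  by rewrite -mulrBr; apply: JM.
move=> u v /asboolP hu /asboolP hv; apply/asboolP; rewrite augmM.
(* This identity writes the positive part of a product as a left combination of the positive parts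
   of its factors. *)
have -> : u * v - (augm u * augm v)%:A =
    u * (v - (augm v)%:A) + (augm v)%:A * (u - (augm u)%:A).
  rewrite !mulrBr mulr_algl -scalerAr mulr1 mulr_algl scalerA.
  by rewrite [augm v * _]mulrC addrA subrK.
by apply: JD; apply: JM.
Qed.

Lemma augker_gen1 : generated_deg1 A -> fin_gen augker ->
  exists m (f : {linear gfree A (fun _ : 'I_m => 1) -> augker}),
    gmap f /\ surj f.
Proof.
move=> gA /fin_gen_span fM.
have [x|m [y [hy ys]]] := fM (fun z => homog (gm_gr augker) 1 z); last first.
  by exists m, (row_map y); split=> //; apply: row_map_gmap.
have x0 : augm (augval x 0 0) = 0.
  by rewrite -aug_mapE; apply: (exact_comp0 (exact_gkerval aug_map_gmap)).
have [s [sP sE]] := deg1_span (augval x 0 0) gA.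
(* The default 0 for other elements makes the lift to A_{>=1} a total function. *)
have ex (a : A) : exists z, homog (cg_gr A) 1%N a -> augval z = const_mx a.
  have [ha|na] := pselect (homog (cg_gr A) 1%N a); last by exists 0.
  by have [z zE] := augkerP (augm_homog_gt0 ha isT); exists z.
pose z a := sval (cid (ex a)).
have zE a : homog (cg_gr A) 1%N a -> augval (z a) = const_mx a.
  exact: (svalP (cid (ex a))).
exists [seq (p.1, z p.2) | p <- s]; split=> [_ /mapP[p /sP ps ->]|].
  exact: (augker_homog ps (zE _ ps)).
apply: (@gkerval_inj _ _ _ _ _ aug_map_gmap); rewrite -/augval.
apply/rowP => j; rewrite (ord1 j) big_map linear_sum summxE.
move: sE; rewrite x0 scale0r subr0 => ->; rewrite !big_seq.
by apply: eq_bigr => p /sP ps; rewrite linearZ /= zE // !mxE.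
Qed.

End Augmentation.

Lemma res_triv_fin_gen (k : fieldType) (T A : cgalg k)
    (phi : {lrmorphism T -> A}) (h : graded_map phi) :
  fin_gen (gres h (triv_mod A)).
Proof.
exists 1%N, (row_map (fun=> (1 : k) : gres h (triv_mod A))) => c.
exists (const_mx (c : k)%:A); rewrite row_mapE big_ord1 mxE.
rewrite [LHS]mulr1 linearZ /= rmorph1; exact: augm_scalar.
Qed.

(** * Veronese modules *)

Section VeroneseModule.
Variables (k : fieldType) (A : cgalg k) (d : nat) (d_gt1 : (1 < d)%N).
Local Notation B := (veronese A d_gt1).
Implicit Types K M N : gmod A.
Local Notation cmp M := (comp (gm_gr M)).

Lemma ver_eq0 (b : B) i : ~~ (d %| i)%N -> comp (cg_gr A) i (val b) = 0.
Proof. by move: i; apply/ver_predP; apply: (valP b). Qed.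

Section Object.
Variables (t : int) (M : gmod A).

(* The phantom proof of 1 < d lets vmod determine the ring veronese A d_gt1. *)
Definition vmod_pred of (1 < d)%N : {pred M} :=
  [pred x | `[< forall n, ~~ (d %| n - t)%Z -> cmp M n x = 0 >]].
Local Notation S := (vmod_pred d_gt1).

Lemma vmod_predP x :
  reflect (forall n, ~~ (d %| n - t)%Z -> cmp M n x = 0) (x \in S).
Proof. exact: asboolP. Qed.

Lemma vmod_zmod_closed : zmod_closed S.
Proof.
split=> [|x y]; first by apply/vmod_predP => n _; apply: raddf0.
move=> /vmod_predP hx /vmod_predP hy; apply/vmod_predP => n dn.
by rewrite raddfB /= hx // hy // subrr.
Qed.
HB.instance Definition _ := GRing.isZmodClosed.Build M S vmod_zmod_closed.

Definition vmod : Type := {x : M | x \in S}.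
HB.instance Definition _ := SubChoice.on vmod.
HB.instance Definition _ := [SubChoice_isSubZmodule of vmod by <:].

Lemma vmod_eq0 (x : vmod) n : ~~ (d %| n - t)%Z -> cmp M n (val x) = 0.
Proof. by move: n; apply/vmod_predP; apply: (valP x). Qed.

Lemma vmod_scale_subproof (b : B) (x : vmod) :
  (val b : A) *: val x \in S.
Proof.
apply/vmod_predP => n dn; have [s _ bE] := comp_sum (cg_gr A) (val b).
rewrite (comp_scale_sum _ _ bE) big1 // => i _.
have [di|di] := boolP (d %| i)%N; last first.
  by rewrite ver_eq0 // scale0r.
rewrite ((vmod_predP _) (valP x)) ?scaler0 //.
apply: contra dn => h; rewrite -[n](subrK i%:Z) addrAC.
by apply: rpredD => //; rewrite dvdzE.
Qed.

Definition vmod_scale (b : B) (x : vmod) : vmod :=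
  Sub ((val b : A) *: val x) (vmod_scale_subproof b x).

Lemma vmod_scaleA a b v :
  vmod_scale a (vmod_scale b v) = vmod_scale (a * b) v.
Proof. by apply: val_inj; apply: scalerA. Qed.
Lemma vmod_scale1 : left_id 1 vmod_scale.
Proof. by move=> v; apply: val_inj; apply: scale1r. Qed.
Lemma vmod_scaleDr : right_distributive vmod_scale +%R.
Proof. by move=> a u v; apply: val_inj; apply: scalerDr. Qed.
Lemma vmod_scaleDl v : {morph vmod_scale^~ v : a b / a + b}.
Proof. by move=> a b; apply: val_inj; apply: scalerDl. Qed.
HB.instance Definition _ := GRing.Zmodule_isLmodule.Build B vmod
  vmod_scaleA vmod_scale1 vmod_scaleDr vmod_scaleDl.

Lemma vmod_comp_subproof n (x : vmod) :
  cmp M (d%:Z * n + t) (val x) \in S.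
Proof.
apply/vmod_predP => j dj; rewrite comp_comp; case: eqP => // jE.
by move: dj; rewrite jE addrK dvdz_mulr.
Qed.

Definition vmod_comp n (x : vmod) : vmod :=
  Sub (cmp M (d%:Z * n + t) (val x)) (vmod_comp_subproof n x).

Lemma vmod_comp_additive n : zmod_morphism (vmod_comp n).
Proof. by move=> x y; apply: val_inj; rewrite /= !raddfB. Qed.
HB.instance Definition _ n :=
  GRing.isZmodMorphism.Build vmod vmod (vmod_comp n) (vmod_comp_additive n).

Lemma vmod_d_neq0 : d%:Z != 0.
Proof. by rewrite eqz_nat -lt0n (ltnW d_gt1). Qed.

Lemma vmod_index_inj : injective (fun n : int => d%:Z * n + t).
Proof. by move=> i j /addIr /(mulfI vmod_d_neq0). Qed.

Lemma vmod_comp_comp i j x :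
  vmod_comp i (vmod_comp j x) = if i == j then vmod_comp j x else 0.
Proof.
apply: val_inj; rewrite /= comp_comp (inj_eq vmod_index_inj).
by case: eqP.
Qed.

Lemma vmod_comp_sum x :
  exists2 s : seq int, uniq s & x = \sum_(i <- s) vmod_comp i x.
Proof.
have [s us sE] := comp_sum (gm_gr M) (val x).
have di i : (d %| i - t)%Z -> d%:Z * ((i - t) %/ d)%Z + t = i.
  by move=> h; rewrite mulrC divzK // subrK.
exists [seq ((i - t) %/ d)%Z | i <- s & (d %| i - t)%Z].
  rewrite map_inj_in_uniq ?filter_uniq // => i j.
  rewrite !mem_filter => /andP[/di hi _] /andP[/di hj _] E.
  by rewrite -hi -hj E.
apply: val_inj; rewrite raddf_sum /= big_map big_filter {1}sE.
rewrite (bigID (fun i => d %| i - t)%Z) /= [X in _ + X]big1 ?addr0; last first.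
  by move=> i; apply/vmod_predP; apply: (valP x).
by apply: eq_bigr => i /di ->.
Qed.

Definition vmod_gr : grading int vmod :=
  @Grading int vmod (fun n => vmod_comp n) vmod_comp_comp vmod_comp_sum.

Lemma vmod_homZ (i : nat) (n : int) (b : B) (x : vmod) :
  homog (cg_gr B) i b -> homog vmod_gr n x -> homog vmod_gr (i%:Z + n) (b *: x).
Proof.
move=> /(congr1 val) hb /(congr1 val) hx; apply: val_inj => /=.
by rewrite mulrDr -addrA; apply: (@gm_homZ _ _ _ (d * i)%N).
Qed.

(** The functor V_t, with t any integer and not just a residue: adding d to t keeps the elements and
    lowers their degrees by one. *)
Definition gver : gmod B := GMod vmod_homZ.

(** Projection to the degrees congruent to t; it turns arbitrary preimages into preimages inside the
    Veronese module. *)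
Lemma vmod_proj (x : M) : exists y : vmod,
  forall n, (d %| n - t)%Z -> cmp M n (val y) = cmp M n x.
Proof.
have [s us sP] := comp_finite (gm_gr M) x.
pose s' := [seq i <- s | (d %| i - t)%Z].
pose y := \sum_(i <- s') cmp M i x.
have us' : uniq s' by apply: filter_uniq.
have yS : y \in S.
  apply/vmod_predP => n dn; rewrite (comp_sum_seq _ (fun=> x)) //.
  by rewrite mem_filter (negbTE dn).
exists (Sub y yS) => n dn; rewrite /= (comp_sum_seq _ (fun=> x)) //.
by rewrite mem_filter dn /=; case: ifPn => // /sP.
Qed.

End Object.

Section Map.
Variables (t : int) (M N : gmod A) (f : {linear M -> N}) (gf : gmap f).

Lemma gver_map_subproof (x : gver t M) : f (val x) \in @vmod_pred t N d_gt1.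
Proof.
apply/vmod_predP => n dn; rewrite -gf.
by rewrite vmod_eq0 // linear0.
Qed.

Lemma gver_map_linear :
  linear (fun x : gver t M => Sub (f (val x)) (gver_map_subproof x) : gver t N).
Proof. by move=> a u v; apply: val_inj; apply: linearP. Qed.

Definition gver_map : {linear gver t M -> gver t N} := mklin gver_map_linear.

Lemma gver_mapE x : val (gver_map x) = f (val x). Proof. by []. Qed.

Lemma gver_map_gmap : gmap gver_map.
Proof. by move=> n x; apply: val_inj; apply: gf. Qed.

Lemma gver_map_inj : injective f -> injective gver_map.
Proof. by move=> fi x y /(congr1 val) /= /fi; apply: val_inj. Qed.

End Map.

(** Veronese functors only select graded pieces, and exactness of graded maps holds degree by
    degree. *)
Lemma gver_ses t K M N (i : {linear K -> M}) (q : {linear M -> N}) :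
  gses i q -> exists (i' : {linear gver t K -> gver t M})
    (q' : {linear gver t M -> gver t N}), gses i' q'.
Proof.
move=> [gi gq ii qs ex]; exists (gver_map t gi), (gver_map t gq); split.
- exact: gver_map_gmap.
- exact: gver_map_gmap.
- exact: gver_map_inj.
- move=> y; have [x xE] := qs (val y); have [z zE] := vmod_proj t x.
  exists z; apply: val_inj; rewrite gver_mapE.
  apply: (comp_ext (g := gm_gr N)) => n; rewrite -gq.
  have [dn|dn] := boolP (d %| n - t)%Z; first by rewrite zE // gq xE.
  by rewrite !vmod_eq0 // linear0.
move=> y; split=> [/(congr1 val)|[x <-]]; last first.
  by apply: val_inj; rewrite !gver_mapE (exact_comp0 ex).
rewrite gver_mapE => /ex[x xE].
have xS : x \in @vmod_pred t K d_gt1.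
  apply/vmod_predP => n dn; apply: ii; rewrite gi xE linear0.
  exact: vmod_eq0.
by exists (Sub x xS); apply: val_inj.
Qed.

(** The twist by a is absorbed into the index: both modules have A_{dq + t - a} in degree q. *)
Lemma gver_gfree1_reg e n c t a :
  reg_le e n c (gver (t - a) (gfree1 A 0)) ->
  reg_le e n c (gver t (gfree1 A a)).
Proof.
have cE l (v : 'rV[A]_1) :
    cmp (gfree1 A a) l v = cmp (gfree1 A 0) (l - a) v.
  by apply/rowP => j; rewrite !mxE subr0.
have fS (x : gver (t - a) (gfree1 A 0)) :
    (val x : gfree1 A a) \in @vmod_pred t (gfree1 A a) d_gt1.
  apply/vmod_predP => l dl; rewrite cE; apply: (vmod_eq0 x (n := l - a)).
  by rewrite opprB addrA subrK.
have fl : linear (fun x : gver (t - a) (gfree1 A 0) =>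
    Sub (val x : gfree1 A a) (fS x) : gver t (gfree1 A a)).
  by move=> b u v; apply: val_inj.
apply: (reg_le_iso (f := mklin fl)).
- by move=> l x; apply: val_inj; rewrite /= cE addrA.
- by move=> x y /(congr1 val) xy; apply: val_inj.
move=> y.
have yS : (val y : gfree1 A 0) \in @vmod_pred (t - a) (gfree1 A 0) d_gt1.
  apply/vmod_predP => l dl; have := @vmod_eq0 _ _ y (l + a).
  rewrite cE addrK; apply; apply: contra dl.
  by rewrite opprB addrA.
by exists (Sub (val y : gfree1 A 0) yS); apply: val_inj.
Qed.

(** For t = -dq the degree n piece of V_t A is A_{d(n - q)} = B_{n - q}, so V_t A is B(-q). *)
Lemma gver_free_iso q : exists f : {linear gfree1 B q ->
    gver (- (d%:Z * q)) (gfree1 A 0)}, [/\ gmap f, injective f & surj f].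
Proof.
set t := - _; pose f0 (v : gfree1 B q) : gfree1 A 0 := \row_j val (v 0 j).
have cE n v : cmp (gfree1 A 0) (d%:Z * n + t) (f0 v) =
    f0 (comp (gm_gr (gfree1 B q)) n v).
  apply/rowP => j; rewrite !mxE subr0 -mulrBr.
  case: (n - q) => l; first by rewrite -PoszM.
  (* For n < q both sides are 0: positivity of d(l + 1) keeps the index on the left negative. *)
  rewrite NegzE mulrN -PoszM; have : (0 < d * l.+1)%N by rewrite muln_gt0 ltnW.
  by case: (d * l.+1)%N.
have fS v : f0 v \in @vmod_pred t (gfree1 A 0) d_gt1.
  apply/vmod_predP => n dn; apply/rowP => j; rewrite !mxE subr0.
  case: n dn => // n dn /=; apply: ver_eq0.
  apply: contra dn => dn; rewrite opprK.
  by apply: rpredD; [rewrite dvdzE|apply: dvdz_mulr].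
have fl : linear (fun v => Sub (f0 v) (fS v) : gver t (gfree1 A 0)).
  by move=> b u v; apply: val_inj; apply/rowP => j; rewrite !mxE.
exists (mklin fl); split.
- by move=> n v; apply: val_inj; rewrite /= cE.
- move=> u v /(congr1 val) /rowP uv; apply/rowP => j; apply: val_inj.
  by have := uv j; rewrite !mxE.
move=> y; have yS : (val y : 'rV[A]_1) 0 0 \in @ver_pred k A d.
  apply/ver_predP => i di; have := @vmod_eq0 _ _ y i%:Z.
  rewrite opprK => h; have /rowP/(_ 0) : cmp (gfree1 A 0) i%:Z (val y) = 0.
    apply: h; apply: contra di => h; have := dvdz_mulr q (dvdzz d%:Z).
    by move=> /(rpredB h); rewrite addrK.
  by rewrite !mxE subr0.
pose b : ver_type A d := Sub ((val y : 'rV[A]_1) 0 0) yS.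
exists (const_mx b : 'rV[B]_1); apply: val_inj; apply/rowP => j.
by rewrite !mxE (ord1 j).
Qed.

Lemma gver_triv_iso : exists f : {linear gver 0 (triv_mod A) -> triv_mod B},
  [/\ gmap f, injective f & surj f].
Proof.
have aE (b : B) : augm b = augm (val b : A).
  apply: (@scalarA_inj _ A); rewrite -augmE.
  by have /(congr1 val) := augmE b; rewrite /= muln0 => ->.
have fl : linear (fun x : gver 0 (triv_mod A) => (val x : k) : triv_mod B).
  move=> b u v; rewrite /= /GRing.scale /= /triv_scale.
  by congr (_ + _); rewrite aE.
exists (mklin fl); split.
- move=> n x; rewrite /= /triv_comp addr0 mulf_eq0.
  by rewrite (negbTE vmod_d_neq0).
- by move=> x y xy; apply: val_inj.
move=> y; have yS : (y : k) \in @vmod_pred 0 (triv_mod A) d_gt1.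
  apply/vmod_predP => n; rewrite subr0 /= /triv_comp.
  by case: eqP => // ->; rewrite dvdz0.
by exists (Sub (y : k) yS).
Qed.

(** The module k sits in degree 0, and 0 = dq + t has no solution q. *)
Lemma gver_triv_eq0 t (x : gver t (triv_mod A)) : ~~ (d %| t)%Z -> x = 0.
Proof.
move=> dt; apply: val_inj; have := @vmod_eq0 _ _ x 0.
by rewrite /= /triv_comp eqxx; apply; rewrite add0r rpredN.
Qed.

End VeroneseModule.

(** * Linear resolutions *)

Section LinearResolution.
Variables (k : fieldType) (B : cgalg k).
Implicit Types M : gmod B.

(** Modules with a linear resolution starting in degree c. As [reg_le] bounds degrees only from
    above, the vanishing below c is what makes them exact. *)
Definition koszul_mod (c : int) M : Prop :=
  (forall n, reg_le 1 n c M) /\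
  (forall n (x : M), n < c -> homog (gm_gr M) n x -> x = 0).

(** One step of a linear resolution, kept as data so that it can be iterated by recursion. *)
Record linear_cover (c : int) M := LinearCover {
  lc_rank : nat;
  lc_map : {linear gfree B (fun _ : 'I_lc_rank => c) -> M};
  lc_gmap : gmap lc_map;
  lc_surj : surj lc_map;
  lc_ker : koszul_mod (c + 1) (gker lc_gmap) }.
Arguments lc_gmap {c M} l n x.
Arguments lc_surj {c M} l y.

Lemma gfree_homog_lt m c n (v : gfree B (fun _ : 'I_m => c)) :
  n < c -> homog (gm_gr (gfree B (fun _ : 'I_m => c))) n v -> v = 0.
Proof.
move=> nc /gfree_homogP hv; apply/rowP => j; rewrite mxE.
have := hv j; have : n - c < 0 by rewrite subr_lt0.
by case: (n - c) => // l _ <-.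
Qed.

Lemma koszul_mod_gen c M : koszul_mod c M -> exists m (y : 'I_m -> M),
  (forall j, homog (gm_gr M) c (y j)) /\ surj (row_map y).
Proof.
move=> [hM M0]; have [m [deg [f [gf fs dc]]]] := reg_le_gen (hM 1%N).
apply: fin_gen_span => [|x]; first by exists m, f.
have [v <-] := fs x.
(* Generators of degree below c vanish, so writing 0 for them changes nothing, and 0 counts as
   homogeneous of degree c. *)
exists [seq (v 0 j, if deg j == c then f (delta_mx 0 j) else 0) | j : 'I_m].
split=> [p /imageP[j _ ->] /=|].
  case: eqP => [jc|_]; last exact: homog0.
  by rewrite -jc; apply: (gmap_deg0 gf); apply: gfree_delta.
rewrite (row_map_eq f) big_image /=; apply: eq_bigr => j _; congr (_ *: _).
case: eqP => // /eqP jc; apply: (M0 (deg j)); first by rewrite lt_neqAle jc dc.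
by apply: (gmap_deg0 gf); apply: gfree_delta.
Qed.

(* A nontrivial relation in degree c between generators of degree c has
   coefficients in k, so one generator is redundant. *)
Lemma redundant_gen m c M (y : 'I_m -> M) (v : gfree B (fun _ : 'I_m => c)) :
  homog (gm_gr (gfree B (fun _ : 'I_m => c))) c v -> v != 0 ->
  row_map y v = 0 -> surj (row_map y) ->
  exists m' (s : 'I_m' -> 'I_m), (m' < m)%N /\ surj (row_map (y \o s)).
Proof.
move=> /gfree_homogP hv v0 yv ys.
have ex j : exists a : k, v 0 j = a%:A.
  by apply/cg_hom0; have := hv j; rewrite subrr.
pose a j := sval (cid (ex j)).
have aE j : v 0 j = (a j)%:A by apply: (svalP (cid (ex j))).
have [j0 aj0] : exists j, a j != 0.
  apply/existsP; apply: contraNT v0; rewrite negb_exists => /forallP a0.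
  apply/eqP/rowP => j; rewrite aE mxE.
  by have := a0 j; rewrite negbK => /eqP->; rewrite scale0r.
pose b : B := ((a j0)^-1)%:A.
have bv : b * v 0 j0 = 1 by rewrite aE mulr_algl scalerA mulVf // scale1r.
exists m.-1, (lift j0); split.
  by rewrite ltn_predL (leq_ltn_trans _ (ltn_ord j0)).
have yj0 : y j0 = - \sum_l (b * v 0 (lift j0 l)) *: y (lift j0 l).
  rewrite -[y j0]scale1r -bv -scalerA.
  have := yv; rewrite row_mapE (bigD1_ord j0) //= => /eqP; rewrite addr_eq0.
  move=> /eqP->; rewrite scalerN scaler_sumr; congr (- _).
  by apply: eq_bigr => l _; rewrite scalerA.
move=> x; have [w <-] := ys x.
exists (\row_l (w 0 (lift j0 l) - w 0 j0 * (b * v 0 (lift j0 l)))).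
rewrite !row_mapE [RHS](bigD1_ord j0) //= yj0 scalerN scaler_sumr -sumrN.
rewrite -big_split.
by apply: eq_bigr => l _; rewrite mxE scalerBl scalerA addrC.
Qed.

(** With the least number of generators there is no relation in degree c, so the kernel starts in
    degree c + 1; the upper bounds come from [reg_le_ker]. The statement is an existence in Prop,
    from which [koszul_cover] extracts the record by choice. *)
Lemma linear_coverP c M : koszul_mod c M -> exists _ : linear_cover c M, True.
Proof.
move=> hM; pose Q m := `[< exists y : 'I_m -> M,
  (forall j, homog (gm_gr M) c (y j)) /\ surj (row_map y) >].
have exQ : exists m, Q m.
  by have [m [y yP]] := koszul_mod_gen hM; exists m; apply/asboolP; exists y.
have [m /asboolP[y [hy ys]] minm] := ex_minnP exQ.
pose f : {linear gfree B (fun _ : 'I_m => c) -> M} := row_map y.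
have gf : gmap f by apply: row_map_gmap.
have ses := gker_gses gf ys.
suff hK : koszul_mod (c + 1) (gker gf) by exists (LinearCover ys hK).
split=> [n|n x nc hx].
  apply: (reg_le_ker ses _ _ (hM.1 n.+1)) => //.
    by rewrite -addrA lerDl.
  apply: reg_le_proj; first exact: gfree_gproj.
  by apply: gen_le_free => j; rewrite lerDl.
apply: (@gkerval_inj _ _ _ _ _ gf); rewrite linear0.
have hv := gmap_deg0 (@gkerval_gmap _ _ _ _ _ gf) hx.
move: nc; rewrite ltzD1 le_eqVlt => /orP[/eqP nc|nc]; last first.
  exact: gfree_homog_lt hv.
apply/eqP; apply/negPn/negP => v0.
have fv : f (gkerval gf x) = 0 by apply: (exact_comp0 (exact_gkerval gf)).
rewrite nc in hv; have [m' [s [m'm ys']]] := redundant_gen hv v0 fv ys.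
have /minm : Q m' by apply/asboolP; exists (y \o s); split=> // j; apply: hy.
by rewrite leqNgt m'm.
Qed.

Definition koszul_cover c M (h : koszul_mod c M) : linear_cover c M :=
  sval (cid (linear_coverP h)).

(** * The linear resolution of the trivial module *)

Section Resolution.
Hypothesis hk : koszul_mod 0 (triv_mod B).

Lemma koszul_modS (i : nat) M : koszul_mod (i%:Z + 1) M -> koszul_mod i.+1%:Z M.
Proof. by rewrite -PoszD addn1. Qed.

(** Iterated syzygies of k; each carries the proof of linearity from which the next cover is
    chosen. *)
Fixpoint lin_syz (i : nat) : {M : gmod B | koszul_mod i%:Z M} :=
  if i is i'.+1 then
    let c := koszul_cover (svalP (lin_syz i')) in
    exist _ (gker (lc_gmap c)) (koszul_modS (lc_ker c))
  else exist _ (triv_mod B) hk.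

Definition syz_cover i : linear_cover i%:Z (sval (lin_syz i)) :=
  koszul_cover (svalP (lin_syz i)).

Definition lin_free (i : nat) : gmod B :=
  gfree B (fun _ : 'I_(lc_rank (syz_cover i)) => i%:Z).

Definition lin_diff i : {linear lin_free i.+1 -> lin_free i} :=
  (gkerval (lc_gmap (syz_cover i)) \o lc_map (syz_cover i.+1))%FUN.

Definition lin_aug : {linear lin_free 0 -> triv_mod B} := lc_map (syz_cover 0).

Lemma lin_diff_gmap i : gmap (lin_diff i).
Proof.
by apply: gmap_comp; [exact: gkerval_gmap|exact: lc_gmap].
Qed.

Lemma exact_lin_diff i : exact (lin_diff i) (lc_map (syz_cover i)).
Proof.
move=> y; rewrite (exact_gkerval (lc_gmap (syz_cover i))).
split=> -[x <-]; last by exists (lc_map (syz_cover i.+1) x).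
by have [z <-] := lc_surj (syz_cover i.+1) x; exists z.
Qed.

Lemma lin_free_graded_free i : graded_free (lin_free i).
Proof.
exists 'I_(lc_rank (syz_cover i)), (fun j => delta_mx 0 j), (fun _ => i%:Z).
split.
- by move=> j; apply: gfree_delta.
- move=> x; exists (index_enum _), (fun j => x 0 j); exact: row_sum_delta.
move=> s c us /rowP s0 j js; have := s0 j; rewrite summxE (bigD1_seq j) //=.
rewrite big1 ?addr0 => [|l lj]; rewrite !mxE eqxx /=.
  by rewrite eqxx mulr1.
by rewrite eq_sym (negbTE lj) mulr0.
Qed.

Lemma lin_resolution : graded_free_resolution lin_diff lin_aug.
Proof.
split; [split| | |].
- exact: (lc_surj (syz_cover 0)).
- exact: exact_lin_diff.
- move=> i y; rewrite -(exact_lin_diff y) /=.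
  split=> [|->]; last exact: linear0.
  rewrite -(linear0 (gkerval (lc_gmap (syz_cover i)))).
  exact: (@gkerval_inj _ _ _ _ _ (lc_gmap (syz_cover i))).
- exact: lin_free_graded_free.
- by move=> i; apply/gmap_deg0/lin_diff_gmap.
exact/gmap_deg0/(lc_gmap (syz_cover 0)).
Qed.

(** The i-th free module is generated in degree i: it vanishes below i, and its elements of degree
    above i have coefficients in B_{>=1}, so their classes in the tensor product with k are 0. *)
Lemma koszul_mod_koszul : koszul B.
Proof.
move=> i j ij; exists lin_free, lin_diff, lin_aug.
split; first exact: lin_resolution.
move=> x hx _; exists 0; rewrite linear0 subr0.
have [ji|ij'] := leP j i%:Z.
  have x0 : x = 0 by apply: gfree_homog_lt hx; rewrite lt_neqAle ij ji.
  by exists [::]; rewrite big_nil.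
exists [seq (x 0 l, (delta_mx 0 l : lin_free i)) | l <- index_enum _]; split.
  move=> _ /mapP[l _ ->] /=; have /gfree_homogP/(_ l) := hx.
  have : 0 < j - i%:Z by rewrite subr_gt0.
  case: (j - i%:Z) => // -[|n] // _ hl.
  by apply: augm_homog_gt0 hl _.
by rewrite big_map; apply: row_sum_delta.
Qed.

End Resolution.
End LinearResolution.

(** * Linearity over high Veronese subrings *)

Section VeroneseRegularity.
Variables (k : fieldType) (T A : cgalg k) (phi : {lrmorphism T -> A}).
Hypothesis phi_gr : graded_map phi.
Variables (d : nat) (d_gt1 : (1 < d)%N).
(** Bounds for the T-regularity of A, of A_{>=1}, and of the kernel Z of a cover of A_{>=1} by
    generators of degree 1. *)
Variables (rA rO rZ : int).
Hypothesis hA : forall n, reg_le 0 n rA (gres phi_gr (gfree1 A 0)).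
Hypotheses (rA0 : 0 <= rA) (rAd : rA <= d%:Z).
Hypotheses (rOd : rO <= d%:Z) (rZd : rZ <= d%:Z).

(** The degree q piece of V_t A is A_{dq + t}, so the condition on q admits every integer from the
    least possible degree of V_t A upwards; the claim is linearity up to stage n. *)
Definition ver_linear (n : nat) : Prop := forall t q : int,
  0 <= t + d%:Z * q -> reg_le 1 n q (gver d_gt1 t (gfree1 A 0)).

Lemma ver_gfree_reg n e m (deg : 'I_m -> int) t q :
  (forall j, reg_le e n q (gver d_gt1 t (gfree1 A (deg j)))) ->
  reg_le e n q (gver d_gt1 t (gfree A deg)).
Proof.
elim: m deg => [|m IHm] deg hd.
  by apply: reg_le_zero => v; apply: val_inj; apply/rowP => -[].
have [i [p ses]] := gfree_ses A deg.
have [i' [p' ses']] := gver_ses d_gt1 t ses.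
by apply: (reg_le_ext ses'); [apply: IHm => j; apply: hd|apply: hd].
Qed.

(** Cover Z by a free A-module with generators of degrees a <= r. Since r <= t + dq, each summand
    V_{t - a} A falls under [ver_linear]. The kernel has T-regularity at most r + rA, and rA <= d
    gives r + rA <= t + d(q + 1), as the next stage requires. *)
Lemma ver_res_reg n n' Z t q r : ver_linear n -> (n' <= n)%N ->
  (forall N, reg_le 0 N r (gres phi_gr Z)) -> r <= t + d%:Z * q ->
  reg_le 1 n' q (gver d_gt1 t Z).
Proof.
move=> hn; elim: n' Z q r => // n' IHn Z q r n'n hZ rq.
have [m [deg [f [gf fs dr]]]] := gen_le_res (reg_le_gen (hZ 1%N)).
have ses := gker_gses gf fs; have [i' [f' ses']] := gver_ses d_gt1 t ses.
apply: (reg_le_coker ses').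
  apply: (IHn _ _ (r + rA)) => //; first exact: ltnW.
    by apply: (res_ker_reg hA ses dr _ _ hZ); rewrite ?lerDl // addrC.
  by rewrite mulrDr mulr1 addrA; apply: lerD.
apply: ver_gfree_reg => j; apply: gver_gfree1_reg.
apply: (reg_le_leq n'n); apply: hn; rewrite addrAC subr_ge0.
exact: le_trans (dr j) rq.
Qed.

Hypothesis hO : forall n, reg_le 0 n rO (gres phi_gr (augker A)).
Variables (m : nat) (f : {linear gfree A (fun _ : 'I_m => 1) -> augker A}).
Hypotheses (gf : gmap f) (fs : surj f).
Hypothesis hZ : forall n, reg_le 0 n rZ (gres phi_gr (gker gf)).

(** Inner induction on u = t + dq: the cover of V_t A uses stage n + 1 for smaller u, and only the
    kernel falls back on stage n. *)
Lemma ver_linearS n : ver_linear n -> ver_linear n.+1.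
Proof.
move=> hn t q; move E: (t + d%:Z * q) => [u|//] _.
have d0 := ltnW d_gt1.
elim/ltn_ind: u t q E => u IHu t q E.
have [u0|u_gt0] := posnP u.
  have tE : t = - (d%:Z * q) by apply/eqP; rewrite -addr_eq0 E u0.
  have [g [gg gi gs]] := gver_free_iso A d_gt1 q; rewrite tE.
  apply: (reg_le_iso gg gi gs); apply: reg_le_proj; first exact: gfree_gproj.
  exact: gen_le_free.
(* For u >= d the sharper bound q - 1 is available, and it lowers u by d. *)
have [du|ud] := leqP d u.
  apply: (@reg_le_mono _ _ _ _ (q - 1)); first by rewrite gerBl.
  apply: (IHu (u - d)%N); first by rewrite ltn_subrL d0.
  by rewrite mulrBr mulr1 addrA E subzn.
have [j [a sesO]] := gver_ses d_gt1 t (augker_ses A).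
(* Here 0 < u < d, and u is congruent to t modulo d. *)
have dt : ~~ (d %| t)%Z.
  have -> : t = u%:Z - d%:Z * q by rewrite -E addrK.
  rewrite rpredBr ?dvdz_mulr // dvdzE /=.
  by apply/negP => /(dvdn_leq u_gt0); rewrite leqNgt ud.
(* As V_t k = 0, the inclusion of V_t A_{>=1} in V_t A is an isomorphism. *)
apply: (reg_le_iso (f := j)); [by case: sesO|by case: sesO| |].
  by move=> y; case: sesO => _ _ _ _ ex; apply/ex/gver_triv_eq0.
have [i [p ses]] := gver_ses d_gt1 t (gker_gses gf fs).
apply: (reg_le_coker ses).
  (* The kernel V_t Z is needed from degree q + 1 on, and rZ <= d <= u + d = t + d(q + 1). *)
  apply: (ver_res_reg hn (leqnn n) hZ); rewrite mulrDr mulr1 addrA E.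
  by rewrite (le_trans rZd) // lerDr.
(* Generators of degree 1 turn the cover into copies of V_{t - 1} A, for which u drops by one. *)
apply: ver_gfree_reg => l; apply: gver_gfree1_reg.
apply: (IHu u.-1); first by rewrite ltn_predL.
by rewrite addrAC E -subn1 subzn.
Qed.

Lemma veronese_koszul : koszul (veronese A d_gt1).
Proof.
have hn n : ver_linear n by elim: n => // n; apply: ver_linearS.
apply: koszul_mod_koszul; split=> [n|n x n0]; last first.
  by rewrite /homog /= /triv_comp lt_eqF.
have [g [gg gi gs]] := gver_triv_iso A d_gt1.
apply: (reg_le_iso gg gi gs); apply: reg_leS.
(* The trivial B-module is V_0 k, the cokernel of V_0 A_{>=1} -> V_0 A. The kernel term enters in
   degree 1, where rO <= d suffices. *)
have [i [p ses]] := gver_ses d_gt1 0 (augker_ses A).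
apply: (reg_le_coker ses); last by apply: hn.
by apply: (ver_res_reg (hn n) (leqnn n) hO); rewrite add0r add0r mulr1.
Qed.

End VeroneseRegularity.

Theorem corollary0p11 (k : fieldType) (A : cgalg k) (T : cgalg k)
    (phi : {lrmorphism T -> A}) :
  noetherian A -> generated_deg1 A ->
  noetherian T -> finite_gldim T ->
  graded_map phi -> finite_map phi ->
  exists d0 : nat, forall (d : nat) (d_gt1 : (1 < d)%N),
    (d0 <= d)%N -> koszul (veronese A d_gt1).
Proof.
move=> _ gA [nT _] gT phi_gr phi_fin.
have [r hr] := bounded_reg nT gT (res_gfree1_fin_gen phi_gr 0 phi_fin).
have [r' hr'] := bounded_reg nT gT (res_triv_fin_gen phi_gr).
(* Nonnegativity of rA makes the successive syzygy bounds r, r + rA, and so on, nondecreasing. *)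
pose rA := Num.max r 0; have rA0 : 0 <= rA by rewrite le_max lexx orbT.
have hA n : reg_le 0 n rA (gres phi_gr (gfree1 A 0)).
  by apply: reg_le_mono (hr n); rewrite le_max lexx.
(* The bound of [res_ker_reg] for A_{>=1}: r' comes from k, and rA from A, generated in degree 0. *)
pose rO := Num.max r' rA.
have hO n : reg_le 0 n rO (gres phi_gr (augker A)).
  apply: (res_ker_reg hA (augker_ses A) _ _ _ hr').
  - by move=> j; exact: lexx.
  - by rewrite le_max lexx.
  - by rewrite addr0 le_max lexx orbT.
have fO : fin_gen (augker A).
  exact: gen_le_fin_gen (gen_le_res (reg_le_gen (hO 1%N))).
have [m [f [gf fs]]] := augker_gen1 gA fO.
(* The same bound one syzygy further; the free cover now has generators of degree 1, whence rA +
   1. *)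
pose rZ := Num.max rO (rA + 1).
have hZ n : reg_le 0 n rZ (gres phi_gr (gker gf)).
  apply: (res_ker_reg hA (gker_gses gf fs) _ _ _ hO).
  - by move=> j; exact: lexx.
  - by rewrite le_max lexx.
  - by rewrite le_max lexx orbT.
have rZ0 : 0 <= rZ by rewrite le_max addr_ge0 ?orbT.
(* By construction rZ dominates rO, which dominates rA, so d >= rZ gives all three inequalities; rZ
   >= 0 allows it to be read as a natural number. *)
exists `|rZ|%N => d d_gt1; rewrite -lez_nat gez0_abs // => rZd.
have rOd : rO <= d%:Z by apply: le_trans rZd; rewrite le_max lexx.
have rAd : rA <= d%:Z by apply: le_trans rOd; rewrite le_max lexx orbT.
exact: (veronese_koszul d_gt1 hA rA0 rAd rOd rZd hO fs hZ).
Qed.
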